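(* Let $t\ge 1$ be an integer and let $i\in\{2,4,6,8\}$; put $n=i+8(t+1)$ (so $n$ ranges over all even integers $\ge 18$, each arising from exactly one such pair $(t,i)$). Construct the graph $G''_n$ as follows. (1) Take $t+1$ vertex-disjoint paths $u_s^1u_s^2u_s^3u_s^4$ for $s=0,1,\dots,t$, add a new vertex $u$, and add the edges $u_s^1u_{s+1}^1$ and $u_s^4u_{s+1}^3$ for $s=0,1,\dots,t-1$, together with the edges $uu_t^1$ and $uu_t^4$. Call the result $G_t$. (2) Let $S=\{u_0^1,u_0^3,u\}\cup\{u_s^2,u_s^4 : s=0,1,\dots,t\}$ (so $|S|=2t+5$). Let $G'_t$ be obtained from $G_t$ by adding a new vertex $u'$ and the edges $u'v$ for all $v\in S$. In $G'_t$ every vertex other than $u'$ has degree $3$. (3) Let $S_1=S\setminus\{u_t^2,u_t^4,u\}$, $S_2=S\setminus\{u_t^4,u\}$, $S_3=S\setminus\{u\}$, $S_4=S$. Let $G''_n$ be the graph obtained from $G'_t$ by performing a triangle-insertion at every vertex of $S_{i/2}$. Then $|V(G''_n)|=n$. Then $G''_n$ is an extremal brick, and consequently the number of perfect matchings of $G''_n$ is $(5n+8-i)/8$.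
   Context: Graphs are finite, loopless, and may have multiple edges. A connected graph with at least two vertices is matching covered if every edge lies in some perfect matching. For $X\subseteq V(G)$, $\partial_G(X)$ denotes the set of edges with exactly one end in $X$; in a matching covered graph such a cut is tight if every perfect matching contains exactly one of its edges, and it is trivial if $|X|=1$ or $|V(G)\setminus X|=1$. A brick is a nonbipartite matching covered graph with no nontrivial tight cuts (equivalently, a 3-connected graph $G$ such that $G-\{x,y\}$ has a perfect matching for every pair of distinct vertices $x,y$). A brick $G$ is extremal if its number of perfect matchings equals $|E(G)|-|V(G)|+1$. Triangle-insertion at a vertex $v$ of degree $3$ with incident edges $va_1,va_2,va_3$: delete $v$, add three new vertices $b_1,b_2,b_3$ forming a triangle, and add the edges $a_jb_j$ for $j=1,2,3$ (i.e., splicing the graph at $v$ with $K_4$ at a vertex). Performing triangle-insertions at several degree-3 vertices means doing this at each of them. *)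

(* Defs.v *)
From mathcomp Require Import all_boot.

Set Implicit Arguments.
Unset Strict Implicit.
Unset Printing Implicit Defensive.

(* Finite loopless multigraphs: each edge carries its set of two ends, and
   distinct edges may have the same ends. *)
Record mgraph := MGraph {
  vert : finType;
  edge : finType;
  ends : edge -> {set vert};
  card_ends : forall e, #|ends e| = 2 }.

Section Notions.
Variable G : mgraph.

Definition incident (v : vert G) : {set edge G} := [set e | v \in ends e].

Definition degree (v : vert G) : nat := #|incident v|.

Definition adjacent : rel (vert G) :=
  [rel x y | [exists e : edge G, ends e == [set x; y]]].

Definition connected : Prop := forall x y : vert G, connect adjacent x y.

Definition perfect_matching (M : {set edge G}) : bool :=
  [forall v : vert G, #|M :&: incident v| == 1].

Definition num_perfect_matchings : nat :=
  #|[set M : {set edge G} | perfect_matching M]|.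

Definition matching_covered : Prop :=
  [/\ connected, 2 <= #|vert G| &
      forall e : edge G, exists2 M, perfect_matching M & e \in M].

Definition cut (X : {set vert G}) : {set edge G} :=
  [set e | #|ends e :&: X| == 1].

Definition tight_cut (X : {set vert G}) : Prop :=
  forall M, perfect_matching M -> #|M :&: cut X| = 1.

Definition trivial_cut (X : {set vert G}) : Prop := #|X| = 1 \/ #|~: X| = 1.

Definition bipartite : Prop :=
  exists A : {set vert G}, forall e : edge G, e \in cut A.

Definition brick : Prop :=
  [/\ matching_covered, ~ bipartite &
      forall X : {set vert G}, tight_cut X -> trivial_cut X].

(* The number of perfect matchings is |E| - |V| + 1, without truncated
   subtraction. *)
Definition extremal_brick : Prop :=
  brick /\ num_perfect_matchings + #|vert G| = #|edge G| + 1.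

End Notions.

(* The simple graph of the symmetric closure of r, loops discarded. *)
Section SimpleGraph.
Variables (V : finType) (r : rel V).

Definition simple_edge : finType :=
  {A : {set V} | [exists x, exists y, [&& x != y, r x y & A == [set x; y]]]}.

Lemma card_simple_ends (A : simple_edge) : #|val A| = 2.
Proof.
by case: A => A /= /existsP[x /existsP[y /and3P[xy _ /eqP->]]]; rewrite cards2 xy.
Qed.

Definition simple_mgraph : mgraph := MGraph card_simple_ends.

End SimpleGraph.

(* G with a new vertex None joined by one edge to each vertex of S. *)
Section AddVertex.
Variables (G : mgraph) (S : {set vert G}).

Definition add_vertex_edge : finType := (edge G + {v : vert G | v \in S})%type.

Definition add_vertex_ends (e : add_vertex_edge) : {set option (vert G)} :=
  match e with
  | inl e => Some @: ends e
  | inr v => [set None; Some (val v)]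
  end.

Lemma card_add_vertex_ends e : #|add_vertex_ends e| = 2.
Proof.
case: e => [e|v] /=; last by rewrite cards2.
by rewrite card_imset ?card_ends // => x y [].
Qed.

Definition add_vertex : mgraph := MGraph card_add_vertex_ends.

End AddVertex.

(* Simultaneous triangle-insertion at all vertices of T.  Each v in T is
   replaced by the vertices inr (v, e), one for each edge e incident with v, and
   these are made pairwise adjacent; every old edge e keeps its identity, its
   end v in T being moved to inr (v, e).  This replaces v by a triangle exactly
   when v has degree 3, the only case in which it is meant to be used. *)
Section TriangleInsertion.
Variables (G : mgraph) (T : {set vert G}).

Definition ti_vert_pred (x : vert G + vert G * edge G) : bool :=
  match x with
  | inl v => v \notin T
  | inr (v, e) => (v \in T) && (v \in ends e)
  end.

Definition ti_vert : finType :=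
  {x : vert G + vert G * edge G | ti_vert_pred x}.

Definition ti_corners (v : vert G) : {set ti_vert} :=
  [set x | if val x is inr (w, _) then w == v else false].

Definition ti_edge : finType :=
  (edge G + {A : {set ti_vert} |
               (#|A| == 2) && [exists v, A \subset ti_corners v]})%type.

Definition ti_ends (e : ti_edge) : {set ti_vert} :=
  match e with
  | inl e => [set x | match val x with
                      | inl v => v \in ends e
                      | inr (_, f) => f == e
                      end]
  | inr A => val A
  end.

Lemma card_ti_ends e : #|ti_ends e| = 2.
Proof.
case: e => [e|[A /= /andP[/eqP]]//] /=.
rewrite -(card_ends e).
pose p (x : ti_vert) := match val x with inl v => v | inr (v, _) => v end.
rewrite -(@card_in_imset _ _ p) => [|[x Px] [y Py]]; last first.
  rewrite !inE /p /=; move: x y Px Py.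
  move=> [v|[v f]] [w|[w g]] Px Py /=.
  - by move=> _ _ vw; apply: val_inj; rewrite /= vw.
  - by move=> _ _ vw; subst w; case/andP: (Py) => /(negP Px).
  - by move=> _ _ vw; subst w; case/andP: (Px) => /(negP Py).
  - by move=> /eqP fe /eqP ge vw; apply: val_inj; rewrite /= vw fe ge.
apply: eq_card => v; apply/imsetP/idP => [[[x Px]]|ve].
  rewrite inE /p /=; case: x Px => [w|[w f]] /= Px we -> //.
  by move: Px; rewrite (eqP we) => /andP[].
have [vT|vT] := boolP (v \in T).
  have P : ti_vert_pred (inr (v, e)) by rewrite /= vT.
  by exists (exist _ (inr (v, e)) P); rewrite ?inE /=.
by exists (exist _ (inl v) vT); rewrite ?inE.
Qed.

Definition triangle_insertion : mgraph := MGraph card_ti_ends.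

End TriangleInsertion.

Section Family.
Variable t : nat.

(* Some (s, j) is u_s^(j+1) and None is u. *)
Definition Gt_vert : finType := option ('I_t.+1 * 'I_4).

Definition Gt_rel : rel Gt_vert := fun x y =>
  match x, y with
  | Some (s, j), Some (s', j') =>
         (s == s') && (j' == j.+1 :> nat)
      || (s' == s.+1 :> nat)
         && ((j == 0 :> nat) && (j' == 0 :> nat)
             || (j == 3 :> nat) && (j' == 2 :> nat))
  | None, Some (s, j) =>
         (s == t :> nat) && ((j == 0 :> nat) || (j == 3 :> nat))
  | _, None => false
  end.

Definition Gt : mgraph := simple_mgraph Gt_rel.

(* u_ s k is u_s^k with the superscript k in 1..4, for s <= t. *)
Definition u_ (s k : nat) : vert Gt := Some (inord s, inord k.-1).

Definition uu : vert Gt := None.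

Definition Sset : {set vert Gt} :=
  [set u_ 0 1; u_ 0 3; uu]
    :|: [set u_ (nat_of_ord s) 2 | s : 'I_t.+1]
    :|: [set u_ (nat_of_ord s) 4 | s : 'I_t.+1].

Definition Gt' : mgraph := add_vertex Sset.

Definition u' : vert Gt' := None.

(* S_k for k = 1, 2, 3, 4. *)
Definition Sk (k : nat) : {set vert Gt} :=
  match k with
  | 1 => Sset :\: [set u_ t 2; u_ t 4; uu]
  | 2 => Sset :\: [set u_ t 4; uu]
  | 3 => Sset :\: [set uu]
  | _ => Sset
  end.

(* The graph G''_n for n = i + 8 (t + 1); the vertices of Gt are the Some _
   among those of Gt'. *)
Definition G'' (i : nat) : mgraph :=
  @triangle_insertion Gt' (Some @: Sk i./2).

End Family.

(* Main.v *)
Require Import Defs.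
From mathcomp Require Import all_boot all_order all_algebra zify.

(** A perfect matching of a triangle-insertion leaves on the original graph an
    "odd factor": an edge set of degree 1 everywhere, except that degree 3 is
    allowed at the vertices of T; this correspondence is bijective.  In G'_t the
    edges at u' in an odd factor are forced by parity, and the rest is read off
    layer by layer (one layer per path u_s^1 .. u_s^4) by a small automaton whose
    state is the trace on the two edges leaving the layer; its words are counted
    by recursion.

    For bricks, let X be a tight cut and f its indicator on edges.  In each
    inserted triangle at most one corner lies on the other side of X than the two
    others; giving weight 1 to these corners and subtracting their weights from
    f, one gets a function on E(G'_t) with constant sum on odd factors.  Comparing
    odd factors that differ locally shows that this function is induced by a
    vertex potential vanishing on T.  Hence f(e) is the sum of the weights of the
    two ends of e, for an integral weight on the vertices of G''_n.  The weight
    has total 1, and summing it layer by layer shows that it is nonnegative, so it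
    is the indicator of a single vertex z; since the graph is connected, X is {z}
    or its complement. *)

Set Implicit Arguments.
Unset Strict Implicit.
Unset Printing Implicit Defensive.

Import Order.TTheory GRing.Theory Num.Theory.

(** * Cuts and perfect matchings *)

(** At a vertex of degree 3 whose degree in F is odd, the third edge is present exactly when the
    other two agree; this is why the edges at [u'] need no bits of their own. Only one edge at [u']
    may be used. Once it is used, exactly one of the two outgoing bits is set and the rest of the
    word is forced, so branching occurs only after a prefix of copies of [lay_N]. Each further layer
    thus adds five words, which matches |E| - |V| + 1: a layer, with its triangles, brings 13 edges
    and 8 vertices.

    For tight cuts the obstacle is that the vertex weight obtained from the linear equations is only
    integral; outside T it could a priori be negative. What excludes this is that f takes only the
    values 0 and 1: a negative weight has to be compensated along every edge at that vertex, and the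
    compensation already exceeds the total 1. *)

Lemma sum_nat_mem (I : finType) (A B : {set I}) :
  \sum_(i in A) (i \in B : nat) = #|A :&: B|.
Proof.
rewrite -sum1_card [RHS](eq_bigl (fun i => (i \in A) && (i \in B))).
  by rewrite [RHS]big_mkcondr; apply: eq_bigr => i _; case: (i \in B).
by move=> i; rewrite inE.
Qed.

Lemma sum_nat_memT (I : finType) (B : {set I}) : \sum_i (i \in B : nat) = #|B|.
Proof. by rewrite -[in RHS](setTI B) -sum_nat_mem; apply: eq_bigl => i; rewrite inE. Qed.

Lemma set2_ends (G : mgraph) (e : edge G) :
  exists x y, x != y /\ ends e = [set x; y].
Proof.
by have /eqP/cards2P[x [y [xy ->]]] := card_ends e; exists x, y.
Qed.

Lemma in_cut (G : mgraph) (X : {set vert G}) (e : edge G) x y :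
  x != y -> ends e = [set x; y] -> (e \in cut X) = (x \in X) (+) (y \in X).
Proof.
move=> xy exy; rewrite inE exy setIUl cardsU -setIIl.
rewrite (_ : [set x] :&: [set y] = set0); last first.
  by apply/setP => z; rewrite !inE; case: eqP => [->|//]; rewrite (negPf xy).
have c1 w : #|[set w] :&: X| = (w \in X).
  case: (boolP (w \in X)) => wX; first by rewrite (setIidPl _) ?cards1 ?sub1set.
  by apply/eqP; rewrite cards_eq0 setI_eq0 disjoints1.
by rewrite set0I cards0 subn0 !c1; case: (x \in X); case: (y \in X).
Qed.

Lemma sum_ends (G : mgraph) (R : nmodType) (e : edge G) x y (g : vert G -> R) :
  x != y -> ends e = [set x; y] ->
  (\sum_(v in ends e) g v = g x + g y)%R.
Proof. by move=> xy ->; rewrite big_setU1 ?inE //= big_set1. Qed.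

Lemma perfect_matching_sum (G : mgraph) (R : nmodType) (M : {set edge G})
    (g : vert G -> R) :
  perfect_matching M ->
  (\sum_(e in M) \sum_(v in ends e) g v = \sum_v g v)%R.
Proof.
move=> /forallP PM; rewrite (exchange_big_dep predT) //=; apply: eq_bigr => v _.
rewrite -[RHS]mulr1n -(eqP (PM v)) -sumr_const.
by apply: eq_bigl => e; rewrite !inE.
Qed.

Lemma tight_cut_sum (G : mgraph) (X : {set vert G}) (M : {set edge G}) :
  perfect_matching M -> tight_cut X -> (\sum_(e in M) (e \in cut X)%:Z = 1)%R.
Proof.
move=> PM tX; rewrite (eq_bigr (fun e => (e \in cut X)%:R%R)) => [|e _].
  by rewrite -natr_sum natz sum_nat_mem tX.
by rewrite natz.
Qed.

Lemma tight_cut_trivial (G : mgraph) (X : {set vert G}) (g : vert G -> int) :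
  connected G -> (exists M : {set edge G}, perfect_matching M) -> tight_cut X ->
  (forall e, (e \in cut X)%:Z = \sum_(v in ends e) g v)%R ->
  (forall v, 0 <= g v)%R -> trivial_cut X.
Proof.
move=> conn [M PM] tX gE g0.
have g1 : (\sum_v g v = 1)%R.
  rewrite -(perfect_matching_sum g PM) -(eq_bigr _ (fun e _ => gE e)).
  exact: tight_cut_sum.
have [z gz] : exists z, (g z != 0)%R.
  apply/existsP; rewrite -negb_forall; apply/negP => /forallP g00.
  by move: g1; rewrite big1 // => v _; apply/eqP.
have gzE v : (g v = (v == z)%:Z)%R.
  move: g1; rewrite (bigD1 z) //=.
  have s0 (P : pred (vert G)) : (0 <= \sum_(v | P v) g v)%R by apply: sumr_ge0.
  have [->|vz] := eqVneq v z; first by move: (s0 (fun v => v != z)) (g0 z) gz => /=;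
    set A := bigop _ _ _; lia.
  rewrite (bigD1 v) //=; move: (s0 (fun w => (w != z) && (w != v))) (g0 z) (g0 v) gz => /=.
  by set A := bigop _ _ _; lia.
(* An edge crosses the cut exactly when [z] is one of its ends, so this parity agrees at the two
   ends of every edge. *)
have par x y : connect (@adjacent G) x y ->
    (x \in X) (+) (x == z) = (y \in X) (+) (y == z).
  case/connectP => p; elim: p x => [|w p IH] x /=; first by move=> _ ->.
  move=> /andP[/existsP[e /eqP exw] pth] yE; rewrite -(IH w pth yE).
  have xw : x != w by move: (card_ends e); rewrite exw cards2; case: eqP.
  move: (gE e); rewrite (sum_ends _ xw exw) !gzE (in_cut _ xw exw).
  have : ~~ ((x == z) && (w == z)) by apply: contra xw => /andP[/eqP-> /eqP->].
  by case: (x == z); case: (w == z); case: (x \in X); case: (w \in X).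
have [zX|zX] := boolP (z \in X); [left|right];
  apply/eqP/cards1P; exists z; apply/setP => v; rewrite !inE;
  move: (par v z (conn v z)); rewrite eqxx ?zX ?(negPf zX);
  by case: (v \in X); case: (v == z).
Qed.

(* Edge sets with odd degree at each vertex, where degree 3 is allowed only on
   T: the traces on G of the perfect matchings of its triangle-insertion. *)
Definition odd_factor (G : mgraph) (T : {set vert G}) (F : {set edge G}) : bool :=
  [forall v, (#|F :&: incident v| == 1) ||
             (v \in T) && (#|F :&: incident v| == 3)].

(** * Perfect matchings of a triangle-insertion correspond to odd factors *)

Section TriangleInsertion.
Variables (G : mgraph) (T : {set vert G}).
Hypothesis deg3 : forall v, v \in T -> degree v = 3.

Local Notation TI := (triangle_insertion T).

Definition corner v e (h : ti_vert_pred T (inr (v, e))) : vert TI :=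
  exist _ (inr (v, e)) h.

(** Sending a corner to its outer edge identifies the corners at [v] with the edges at [v]; the
    predicate allows degrees in an edge set to be counted on the triangle. *)
Lemma card_corners v (P : pred (edge G)) : v \in T ->
  #|[set x in ti_corners T v | if val x is inr (_, e) then P e else false]|
  = #|[set e in incident v | P e]|.
Proof.
move=> vT; pose h (x : vert TI) := if val x is inr (_, e) then Some e else None.
rewrite -(@card_in_imset _ _ h) => [|[x Px] [y Py]]; last first.
  rewrite !inE /h /=; move: x y Px Py => [x|[x e]] [y|[y f]] Px Py //=.
  move=> /andP[/eqP xv _] /andP[/eqP yv _] [ef]; apply: val_inj.
  by rewrite /= xv yv ef.
have Sinj : injective (@Some (edge G)) by move=> ? ? [].
rewrite -(card_imset _ Sinj); apply: eq_card => e.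
apply/imsetP/imsetP => [[[[w|[w f]] Px]]|[f]]; rewrite !inE /=.
- by [].
- move=> /andP[/eqP wv Pf] ->; exists f => //; rewrite !inE Pf.
  by move: Px => /=; rewrite wv => /andP[_ ->].
- move=> /andP[vf Pf] ->.
  have Pv : ti_vert_pred T (inr (v, f)) by rewrite /= vT.
  by exists (corner Pv); rewrite // !inE /= eqxx.
Qed.

Lemma card_ti_corners v : v \in T -> #|ti_corners T v| = 3.
Proof.
move=> vT; rewrite -(deg3 vT) /degree.
have := card_corners predT vT; rewrite (_ : [set e in _ | _] = incident v).
  by move=> <-; apply: eq_card => -[[w|[w e]] Px]; rewrite !inE //= andbT.
by apply/setP => e; rewrite !inE andbT.
Qed.

Lemma card_ti_corners0 v : v \notin T -> ti_corners T v = set0.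
Proof.
move=> vT; apply/setP => -[[w|[w e]] Px]; rewrite !inE //=.
by apply/eqP => wv; move: Px vT; rewrite /= wv => /andP[->].
Qed.

Lemma in_corners x v : x \in ti_corners T v -> exists e h, x = @corner v e h.
Proof.
by case: x => -[w|[w e]] Px; rewrite !inE //= => /eqP wv; subst w; exists e, Px.
Qed.

Lemma ti_corners_inj x v w : x \in ti_corners T v -> x \in ti_corners T w -> v = w.
Proof. by move=> /in_corners[e [h ->]]; rewrite !inE /= => /eqP. Qed.

Lemma card_ti_vert : #|vert TI| = #|vert G| + 2 * #|T|.
Proof.
pose pr (x : vert TI) := match val x with inl v => v | inr (v, _) => v end.
rewrite -[LHS]sum1_card (partition_big pr predT) //=.
rewrite (eq_bigr (fun v => 1 + 2 * (v \in T))); last first.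
  move=> v _; rewrite sum1dep_card; have [vT|vT] := boolP (v \in T).
    transitivity #|ti_corners T v|; last exact: card_ti_corners.
    apply: eq_card => -[[w|[w e]] Px]; rewrite !inE //=.
    rewrite /pr /=; apply/negP => /eqP wv; move: Px => /=; rewrite wv.
    by rewrite vT.
  apply/eqP/cards1P; exists (exist _ (inl v) vT); apply/setP => -[[w|[w e]] Px];
    rewrite !inE -val_eqE //= /pr /=.
  by apply/negP => /eqP wv; move: Px => /=; rewrite wv (negPf vT).
by rewrite big_split /= sum1_card -big_distrr sum_nat_memT.
Qed.

Lemma card_ti_edge : #|edge TI| = #|edge G| + 3 * #|T|.
Proof.
rewrite card_sum; congr addn; rewrite card_sig.
pose D v := [set A : {set vert TI} | A \subset ti_corners T v & #|A| == 2].
have cD v : #|D v| = 3 * (v \in T).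
  rewrite cards_draws; case: (boolP (v \in T)) => vT.
    by rewrite card_ti_corners.
  by rewrite card_ti_corners0 // cards0.
rewrite -(@eq_card _ (mem (\bigcup_v D v))); last first.
  move=> A; rewrite [RHS]inE; apply/bigcupP/andP => [[v _]|[A2 /existsP[v sA]]].
    by rewrite inE => /andP[sA A2]; split=> //; apply/existsP; exists v.
  by exists v; rewrite // inE sA.
have dD v w : v != w -> [disjoint D v & D w].
  move=> vw; rewrite -setI_eq0; apply/eqP/setP => A; rewrite !inE.
  apply/negP => /andP[/andP[Av /eqP A2] /andP[Aw _]].
  have /card_gt0P[x xA] : 0 < #|A| by rewrite A2.
  by case/eqP: vw; apply: ti_corners_inj (subsetP Av x xA) (subsetP Aw x xA).
rewrite -[LHS]sum1_card (partition_disjoint_bigcup _ _ dD).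
rewrite (eq_bigr (fun v => 3 * (v \in T))) => [|v _].
  by rewrite -big_distrr sum_nat_memT.
by rewrite sum1_card cD.
Qed.

(** A triangle edge is taken when the outer edges at both its corners are absent. So none is taken
    where F has degree 3, and where F has degree 1 exactly the one opposite to the corner that F
    covers. *)
Definition ti_lift (F : {set edge G}) : {set edge TI} :=
  [set e : ti_edge T | match e with
    | inl e => e \in F
    | inr A => [forall x in val A, if val x is inr (_, e) then e \notin F else true]
    end].

Lemma ti_lift_inj : injective ti_lift.
Proof.
move=> F F' FF'; apply/setP => e.
by move/setP/(_ (inl e)): FF'; rewrite !inE.
Qed.

Lemma perfect_matchingP (H : mgraph) (M : {set edge H}) :
  reflect ((forall v, exists2 e, e \in M & v \in ends e) /\
           (forall v e f, e \in M -> f \in M -> v \in ends e -> v \in ends f -> e = f))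
          (perfect_matching M).
Proof.
apply: (iffP forallP) => [PM|[ex un] v].
  split=> [v|v e f eM fM ve vf]; have /cards1P[g gE] := PM v.
    by exists g; move/setP/(_ g): gE; rewrite !inE eqxx => /andP[].
  move/setP: gE => gE; move: (gE e) (gE f); rewrite !inE eM fM ve vf /=.
  by move=> /esym/eqP-> /esym/eqP->.
have [e eM ve] := ex v; apply/cards1P; exists e; apply/setP => f; rewrite !inE.
apply/andP/eqP => [[fM vf]|->]; last by [].
exact: un fM eM vf ve.
Qed.

Lemma ti_edge_corners (A : {A : {set vert TI} |
    (#|A| == 2) && [exists v, A \subset ti_corners T v]}) x :
  x \in val A -> exists v, [/\ v \in T, x \in ti_corners T v,
    val A \subset ti_corners T v & #|val A| = 2].
Proof.
move: A => [A /= /[dup] PA /andP[/eqP A2 /existsP[v sA]]] xA; exists v; split=> //.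
  by have /in_corners[e [h _]] := subsetP sA x xA; case/andP: h.
exact: (subsetP sA).
Qed.

Lemma ti_lift_matching F : odd_factor T F -> perfect_matching (ti_lift F).
Proof.
move=> /forallP oF; apply/perfect_matchingP; split.
  move=> [[v|[v e]] Px].
    have /orP[/cards1P[e Ee]|/andP[vT]] := oF v; last by case/negP: (Px).
    have : e \in F :&: incident v by rewrite Ee inE.
    by rewrite !inE => /andP[eF ve]; exists (inl e); rewrite !inE.
  have [eF|eF] := boolP (e \in F); first by exists (inl e); rewrite !inE /=.
  have /andP[vT ve] : (v \in T) && (v \in ends e) := Px.
  have c3 := deg3 vT; rewrite /degree in c3.
  (* Since [e] is missing, F does not have degree 3 at [v]. It misses exactly two edges there, and
     their corners form the triangle edge that covers this corner. *)
  have c1 : #|incident v :&: F| = 1.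
    have /orP[/eqP|/andP[_ /eqP c]] := oF v; first by rewrite setIC.
    have /eqP E : F :&: incident v == incident v by rewrite eqEcard subsetIr c c3.
    by move: eF; have : e \in incident v; [rewrite inE|rewrite -E inE => /andP[->]].
  have c2 : #|incident v :\: F| = 2 by move: (cardsID F (incident v)); rewrite c1 c3 => -[].
  have := card_corners (fun e => e \notin F) vT.
  rewrite (_ : [set f in incident v | f \notin F] = incident v :\: F) ?c2; last first.
    by apply/setP => f; rewrite !inE andbC.
  set A := [set x in _ | _] => cA.
  have PA : (#|A| == 2) && [exists v, A \subset ti_corners T v].
    rewrite cA eqxx; apply/existsP; exists v.
    by apply/subsetP => x; rewrite inE => /andP[].
  exists (inr (exist _ A PA)); last by rewrite /= !inE /= eqxx.
  by rewrite inE; apply/forall_inP => -[[y|[y f]] Py]; rewrite inE //= => /andP[].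
move=> x [e|A] [f|B]; rewrite !inE.
- case: x => -[v|[v g]] Px /=; last by move=> _ _ /eqP<- /eqP<-.
  move=> eF fF ve vf; have /orP[/cards1P[g /setP Eg]|/andP[vT]] := oF v; last first.
    by case/negP: (Px).
  move: (Eg e) (Eg f); rewrite !inE eF fF ve vf => /esym/eqP-> /esym/eqP->; by [].
- move=> eF /forall_inP FB xe xB;
  have [v [vT /in_corners[g [h xE]] _ _]] := ti_edge_corners xB.
  by move: xe (FB x xB); rewrite xE /= => /eqP->; rewrite eF.
- move=> /forall_inP FB eF xB xe;
  have [v [vT /in_corners[g [h xE]] _ _]] := ti_edge_corners xB.
  by move: xe (FB x xB); rewrite xE /= => /eqP->; rewrite eF.
move=> /forall_inP FA /forall_inP FB xA xB; congr inr; apply: val_inj.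
have [v [vT xv Av A2]] := ti_edge_corners xA; have [w [_ xw Bw B2]] := ti_edge_corners xB.
rewrite -(ti_corners_inj xv xw) in Bw.
(* [D] is the set of corners that F leaves uncovered. It has at most two elements, so a triangle
   edge of the lift at [v] can only be [D]. *)
pose D := [set x in ti_corners T v | if val x is inr (_, e) then e \notin F else false].
have D2 : #|D| <= 2.
  rewrite /D (card_corners _ vT) (_ : [set _ in _ | _] = incident v :\: F); last first.
    by apply/setP => f; rewrite !inE andbC.
  move: (cardsID F (incident v)) (deg3 vT); rewrite /degree => <-.
  rewrite setIC; move: (oF v); set n := #|_ :&: _|; lia.
have sub (C : {set vert TI}) : C \subset ti_corners T v -> #|C| = 2 ->
    (forall x, x \in C -> if val x is inr (_, e) then e \notin F else true) -> C = D.
  move=> Cv C2 FC; apply/eqP; rewrite eqEcard C2 D2 andbT; apply/subsetP => y yC.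
  rewrite inE (subsetP Cv) //=; move: (FC y yC).
  by have /in_corners[e [h ->]] := subsetP Cv y yC.
by rewrite [LHS](sub _ Av A2 FA) [RHS](sub _ Bw B2 FB).
Qed.

Definition ti_trace (M : {set edge TI}) : {set edge G} :=
  [set e | (inl e : edge TI) \in M].

Lemma ti_matching_lift M : perfect_matching M ->
  odd_factor T (ti_trace M) /\ M = ti_lift (ti_trace M).
Proof.
move=> /perfect_matchingP[ex un]; set F := ti_trace M.
have FE e : (e \in F) = ((inl e : edge TI) \in M) by rewrite inE.
(* Two triangle edges at [v] share a corner, so beside a triangle edge of M the remaining corner
   must be covered by its outer edge. *)
have third A v z : (inr A : edge TI) \in M -> val A \subset ti_corners T v -> v \in T ->
    z \in ti_corners T v -> z \notin val A ->
    if val z is inr (_, e) then e \in F else false.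
  move=> AM Av vT zv zA; have [[e|B] eM] := ex z.
    by have /in_corners[f [h ->]] := zv; rewrite /= FE !inE /= => /eqP->.
  move=> /= zB; have [w [_ zw Bw B2]] := ti_edge_corners zB.
  rewrite -(ti_corners_inj zv zw) in Bw.
  have A2 : #|val A| = 2 by have /andP[/eqP] := valP A.
  have [x xA xB] : exists2 x, x \in val A & x \in val B.
    have : #|val A :|: val B| <= 3.
      by rewrite -(card_ti_corners vT) subset_leq_card // subUset Av.
    rewrite cardsU A2 B2; case: (set_0Vmem (val A :&: val B)) => [->|[x]].
      by rewrite cards0.
    by rewrite inE => /andP[]; exists x.
  by have [AB] := un x _ _ AM eM xA xB; move: zA; rewrite AB zB.
have both e A x : e \in F -> (inr A : edge TI) \in M -> x \in val A ->
    (if val x is inr (_, f) then f == e else false) -> False.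
  move=> eF AM xA xe; move: eF; rewrite FE => eM.
  by have := un x (inl e) (inr A) eM AM; rewrite !inE;
    case: (val x) xe => [//|[v f]] -> /(_ isT xA).
have dF v : v \in T -> #|F :&: incident v| =
    #|[set x in ti_corners T v | if val x is inr (_, e) then e \in F else false]|.
  by move=> vT; rewrite (card_corners _ vT); apply: eq_card => e; rewrite !inE andbC.
split.
  apply/forallP => v; have [vT|vT] := boolP (v \in T); last first.
    rewrite orbF; pose x : vert TI := exist _ (inl v) vT.
    have [[e|A] eM xe] := ex x; last first.
      by have [w [_ /in_corners[e [h]]]] := ti_edge_corners xe.
    apply/cards1P; exists e; apply/setP => f; rewrite in_setI FE !inE.
    apply/andP/eqP => [[fM vf]|->]; last by move: xe; rewrite !inE.
    by have := un x (inl f) (inl e) fM eM; rewrite !inE /= vf => /(_ isT); move: xe;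
      rewrite !inE /= => -> /(_ isT) [].
  rewrite dF //=.
  (* A triangle edge of M at [v] leaves one corner to the outer edges, hence degree 1; without one,
     all three corners use their outer edges, hence degree 3. *)
  have [/existsP[A /andP[AM Av]]|noA] := boolP [exists A, ((inr A : edge TI) \in M) &&
    (val A \subset ti_corners T v)].
    apply/orP; left; rewrite (_ : [set _ in _ | _] = ti_corners T v :\: val A).
      rewrite cardsD (setIidPr Av) card_ti_corners //.
      by have /andP[/eqP-> _] := valP A.
    apply/setP => z; rewrite [LHS]inE [RHS]inE andbC;
      case: (boolP (z \in ti_corners T v)) => zv; rewrite ?andbF // !andbT.
    apply/idP/idP => [zF|zA]; last exact: (third A v z AM Av vT zv zA).
    apply/negP => zA; have /in_corners[e [h zE]] := zv.
    by move: zF zA; rewrite zE => zF zA; apply: (both e A _ zF AM zA (eqxx e)).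
  apply/orP; right; rewrite (_ : [set _ in _ | _] = ti_corners T v) ?card_ti_corners //.
  apply/setP => z; rewrite inE; case: (boolP (z \in ti_corners T v)) => //= zv.
  have [[e|A] eM ze] := ex z.
    by have /in_corners[f [h zE]] := zv; move: ze; rewrite zE /= FE !inE /= => /eqP->.
  have [w [_ zw Aw _]] := ti_edge_corners ze; case/negP: noA; apply/existsP; exists A.
  by rewrite eM (ti_corners_inj zv zw).
apply/setP => -[e|A]; rewrite [RHS]inE ?inE //.
apply/idP/forall_inP => [AM x xA|FA].
  have [v [_ /in_corners[e [h xE]] _ _]] := ti_edge_corners xA; rewrite xE /=.
  by apply/negP => eF; move: xA; rewrite xE => xA; apply: (both e A _ eF AM xA (eqxx e)).
have /andP[/eqP A2 _] := valP A.
have /card_gt0P[x xA] : 0 < #|val A| by rewrite A2.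
have [v [vT xv Av _]] := ti_edge_corners xA.
have [[e|B] eM xe] := ex x.
  by have /in_corners[f [h xE]] := xv; move: xe (FA x xA);
    rewrite xE /= FE !inE /= => /eqP->; rewrite eM.
have [w [_ xw Bw B2]] := ti_edge_corners xe.
rewrite -(ti_corners_inj xv xw) in Bw.
suff -> : A = B by [].
apply: val_inj; apply/eqP; rewrite eqEcard [in X in _ && X]A2 [in X in _ && X]B2 andbT.
apply/subsetP => y yA; apply/negPn/negP => yB.
have := third B v y eM Bw vT (subsetP Av y yA) yB; move: (FA y yA).
by case: (val y) => [//|[? f]] /negPf->.
Qed.

Lemma num_perfect_matchings_ti :
  num_perfect_matchings TI = #|[set F | odd_factor T F]|.
Proof.
rewrite -(card_imset _ ti_lift_inj); apply: eq_card => M; rewrite inE.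
apply/idP/imsetP => [/ti_matching_lift[oF ME]|[F]].
  by exists (ti_trace M); rewrite ?inE.
by rewrite inE => oF ->; apply: ti_lift_matching.
Qed.

End TriangleInsertion.

(** * Matching coveredness and tight cuts of a triangle-insertion *)

Section TriangleInsertionBrick.
Variables (G : mgraph) (T : {set vert G}).
Hypothesis deg3 : forall v, v \in T -> degree v = 3.

Local Notation TI := (triangle_insertion T).

Definition ti_proj (x : vert TI) : vert G :=
  match val x with inl v => v | inr (v, _) => v end.

(** A relation and not a function, because the corner [(v, e)] exists only if [v] is an end of [e].
    It treats kept and expanded vertices uniformly as the end over [v] of the old edge [e]. *)
Definition ti_at (v : vert G) (e : edge G) (x : vert TI) : Prop :=
  val x = if v \in T then inr (v, e) else inl v.

Lemma ti_at_exists v e : v \in ends e -> exists x, ti_at v e x.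
Proof.
move=> ve; rewrite /ti_at; case: (boolP (v \in T)) => vT.
  have Pv : ti_vert_pred T (inr (v, e)) by rewrite /= vT.
  by exists (exist _ (inr (v, e)) Pv).
by exists (exist _ (inl v) vT).
Qed.

Lemma ti_at_proj v e x : ti_at v e x -> ti_proj x = v.
Proof. by rewrite /ti_at /ti_proj => ->; case: ifP. Qed.

Lemma ti_at_ends v e x : v \in ends e -> ti_at v e x ->
  x \in ends (inl e : edge TI).
Proof. by rewrite /ti_at inE => ve ->; case: ifP. Qed.

Lemma ti_ends_inl (e : edge G) a b x y : a != b -> ends e = [set a; b] ->
  ti_at a e x -> ti_at b e y -> x != y /\ ends (inl e : edge TI) = [set x; y].
Proof.
move=> ab eab ax bY.
have xy : x != y.
  by apply: contra ab => /eqP xy; rewrite -(ti_at_proj ax) -(ti_at_proj bY) xy.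
split=> //; apply/esym/eqP; rewrite eqEcard subUset !sub1set cards2 xy.
by rewrite (card_ends (inl e : edge TI)) (ti_at_ends _ ax) ?(ti_at_ends _ bY) // eab !inE
  eqxx ?orbT.
Qed.

Lemma ti_triangle_edge v x y : x \in ti_corners T v -> y \in ti_corners T v ->
  x != y -> exists e : edge TI, ends e = [set x; y].
Proof.
move=> xv yv xy.
have PA : (#|[set x; y]| == 2) && [exists v, [set x; y] \subset ti_corners T v].
  by rewrite cards2 xy; apply/existsP; exists v; rewrite subUset !sub1set xv.
by exists (inr (exist _ [set x; y] PA)).
Qed.

Lemma ti_third v x y : v \in T -> x \in ti_corners T v -> y \in ti_corners T v ->
  x != y -> exists z, [/\ z != x, z != y & ti_corners T v = [set x; y; z]].
Proof.
move=> vT xv yv xy; have sA : [set x; y] \subset ti_corners T v.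
  by rewrite subUset !sub1set xv.
have /eqP/cards1P[z zE] : #|ti_corners T v :\: [set x; y]| = 1.
  by rewrite cardsD (setIidPr sA) card_ti_corners // cards2 xy.
have /setDP[_] : z \in ti_corners T v :\: [set x; y] by rewrite zE inE.
rewrite !inE negb_or => /andP[zx zy]; exists z; split=> //.
rewrite -zE; apply/setP => w; move: (subsetP sA w); set B := [set x; y].
by rewrite in_setU in_setD; case: (w \in B) => //= ->.
Qed.

Lemma ti_proj_corner x : ti_proj x \in T -> x \in ti_corners T (ti_proj x).
Proof.
by case: x => -[v|[v e]] Px; rewrite inE //= => vT; case/negP: (Px).
Qed.

Lemma ti_connected : connected G -> connected TI.
Proof.
move=> conn.
have fib x y : ti_proj x = ti_proj y -> connect (@adjacent TI) x y.
  have [->|xy pxy] := eqVneq x y; first by move=> _; apply: connect0.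
  have [vT|vT] := boolP (ti_proj x \in T).
    have yv : y \in ti_corners T (ti_proj x) by rewrite pxy ti_proj_corner // -pxy.
    have [e eE] := ti_triangle_edge (ti_proj_corner vT) yv xy.
    by apply: connect1; apply/existsP; exists e; rewrite eE.
  have inlE z : ti_proj z \notin T -> val z = inl (ti_proj z).
    by case: z => -[v|[v e]] //= Pz; rewrite /ti_proj /=; case/andP: (Pz) => ->.
  by case/eqP: xy; apply: val_inj; rewrite !inlE // -?pxy.
move=> x y; have /connectP[p] := conn (ti_proj x) (ti_proj y).
elim: p x => [|w p IH] x /=; first by move=> _ xy; apply: fib.
move=> /andP[/existsP[e /eqP exw] pth] yE.
have xw : ti_proj x != w by move: (card_ends e); rewrite exw cards2; case: eqP.
have [x' ax] : exists x', ti_at (ti_proj x) e x' by apply: ti_at_exists;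
  rewrite exw !inE eqxx.
have [w' aw] : exists w', ti_at w e w' by apply: ti_at_exists; rewrite exw !inE eqxx orbT.
apply: (connect_trans (fib x x' _)); first by rewrite (ti_at_proj ax).
apply: (@connect_trans _ _ w'); last by apply: IH; rewrite (ti_at_proj aw).
by apply: connect1; apply/existsP; exists (inl e); have [_ ->] := ti_ends_inl xw exw ax aw.
Qed.

Lemma perfect_matching_odd_factor M : perfect_matching M -> odd_factor T M.
Proof. by move=> /forallP PM; apply/forallP => v; rewrite PM. Qed.

(** For a triangle edge, lift a perfect matching of G containing the edge at the opposite corner:
    the other two edges at [v] are then absent, so the lift takes the given triangle edge. *)
Lemma ti_matching_covered : matching_covered G -> matching_covered TI.
Proof.
move=> [conn V2 cov]; split; first exact: ti_connected.
  by rewrite card_ti_vert //; apply: leq_trans V2 (leq_addr _ _).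
case=> [e|A].
  have [M PM eM] := cov e; exists (ti_lift T M); last by rewrite inE.
  exact/ti_lift_matching/perfect_matching_odd_factor.
have /andP[/eqP A2 _] := valP A.
have /card_gt0P[x xA] : 0 < #|val A| by rewrite A2.
have [v [vT xv Av _]] := ti_edge_corners xA.
have /card_gt0P[z /setDP[zv zA]] : 0 < #|ti_corners T v :\: val A|.
  by rewrite cardsD (setIidPr Av) card_ti_corners // A2.
have [g [h zE]] := in_corners zv.
have [M PM gM] := cov g; exists (ti_lift T M).
  exact/ti_lift_matching/perfect_matching_odd_factor.
rewrite inE; apply/forall_inP => y yA; have [f [k yE]] := in_corners (subsetP Av y yA).
rewrite yE /=; apply/negP => fM; have /perfect_matchingP[_ un] := PM.
have fg : f = g by apply: (un v) => //; [case/andP: (k)|case/andP: (h)].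
by case/negP: zA; rewrite zE (_ : corner h = y) // yE; apply: val_inj; rewrite /= fg.
Qed.

Lemma ti_nonbipartite v : v \in T -> ~ bipartite TI.
Proof.
move=> vT [A cA]; have c3 := card_ti_corners deg3 vT.
have /card_gt1P[x [y [xv yv xy]]] : 1 < #|ti_corners T v| by rewrite c3.
have [z [zx zy vE]] := ti_third vT xv yv xy.
have zv : z \in ti_corners T v by rewrite vE !inE eqxx orbT.
have [e eE] := ti_triangle_edge xv yv xy; have := cA e.
have [f fE] := ti_triangle_edge zv xv zx; have := cA f.
have [g gE] := ti_triangle_edge zv yv zy; have := cA g.
rewrite (@in_cut TI _ _ _ _ xy eE) (@in_cut TI _ _ _ _ zx fE) (@in_cut TI _ _ _ _ zy gE).
by case: (x \in A); case: (y \in A); case: (z \in A).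
Qed.

Lemma ti_sum_corners v (h : vert TI -> int) : v \in T ->
  (\sum_(x in ti_corners T v) h x =
   \sum_(e in incident v) oapp h 0 (insub (inr (v, e) : vert G + vert G * edge G)))%R.
Proof.
move=> vT; have /card_gt0P[x0 _] : 0 < #|ti_corners T v| by rewrite card_ti_corners.
pose c e : vert TI := insubd x0 (inr (v, e) : vert G + vert G * edge G).
have cE e : e \in incident v -> val (c e) = inr (v, e).
  by rewrite inE => ve; rewrite val_insubd /= vT ve.
have -> : ti_corners T v = c @: incident v.
  apply/setP => x; apply/idP/imsetP => [/in_corners[e [h' ->]]|[e ev ->]].
    have ev : e \in incident v by rewrite inE; case/andP: (h').
    by exists e => //; apply: val_inj; rewrite cE.
  by rewrite inE cE.
rewrite big_imset /= => [|e f ev fv /(congr1 val)]; last by rewrite !cE // => -[].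
apply: eq_bigr => e ev; rewrite (insubT (ti_vert_pred T)) /=.
  by move: ev; rewrite inE vT.
move=> h'; congr (h _); apply: val_inj; rewrite cE //.
Qed.

Section TightCut.
Variable X : {set vert TI}.

Definition odd_corner (x : vert TI) : bool :=
  (ti_proj x \in T) &&
  [forall y in ti_corners T (ti_proj x), (y != x) ==> ((y \in X) != (x \in X))].

Lemma odd_cornerE v x y z : v \in T -> x != y -> z != x -> z != y ->
  ti_corners T v = [set x; y; z] ->
  odd_corner x = ((y \in X) != (x \in X)) && ((z \in X) != (x \in X)).
Proof.
move=> vT xy zx zy vE; have xv : x \in ti_corners T v by rewrite vE !inE eqxx.
have px : ti_proj x = v by have [e [h ->]] := in_corners xv.
rewrite /odd_corner px vT vE; apply/forall_inP/andP => [h|[hy hz] w].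
  split; [apply: (implyP (h y _))|apply: (implyP (h z _))];
    by rewrite ?inE ?eqxx ?orbT // eq_sym.
by rewrite !inE => /orP[/orP[]|] /eqP->; apply/implyP; rewrite ?eqxx.
Qed.

(** Either the whole triangle lies on one side of X and both terms vanish, or the triangle edges
    that cross X are the two at the odd corner. *)
Lemma odd_corner_edge v x y : v \in T -> x \in ti_corners T v ->
  y \in ti_corners T v -> x != y ->
  (x \in X) (+) (y \in X) = odd_corner x + odd_corner y :> nat.
Proof.
move=> vT xv yv xy; have [z [zx zy vE]] := ti_third vT xv yv xy.
rewrite (odd_cornerE vT xy zx zy vE).
rewrite (@odd_cornerE v y x z) //; last first.
- by rewrite vE; apply/setP => w; rewrite !inE; case: (w == x); case: (w == y).
- by rewrite eq_sym.
by case: (x \in X); case: (y \in X); case: (z \in X).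
Qed.

Lemma odd_corner_sum v : v \in T ->
  (\sum_(x in ti_corners T v) (odd_corner x)%:Z <= 1)%R.
Proof.
move=> vT; have /card_gt1P[x [y [xv yv xy]]] : 1 < #|ti_corners T v|.
  by rewrite card_ti_corners.
have [z [zx zy vE]] := ti_third vT xv yv xy.
have xz : x != z by rewrite eq_sym.
have yz : y != z by rewrite eq_sym.
have yx : y != x by rewrite eq_sym.
have -> : (\sum_(x in ti_corners T v) (odd_corner x)%:Z =
  (odd_corner x)%:Z + (odd_corner y)%:Z + (odd_corner z)%:Z)%R.
  rewrite vE setUC big_setU1 ?big_setU1 ?big_set1 ?inE ?negb_or ?zx ?xy //=.
  by rewrite addrC.
rewrite (odd_cornerE vT xy zx zy vE) (@odd_cornerE v y x z) //.
  rewrite (@odd_cornerE v z x y) //.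
    by case: (x \in X); case: (y \in X); case: (z \in X).
  by rewrite vE; apply/setP => w; rewrite !inE; case: (w == x); case: (w == y);
    case: (w == z).
by rewrite vE; apply/setP => w; rewrite !inE; case: (w == x); case: (w == y).
Qed.

(** The default 0 makes this total in [v] and [e], so that sums over edges of G carry no proof that
    the corner exists. *)
Definition corner_weight (v : vert G) (e : edge G) : int :=
  oapp (fun x : vert TI => (odd_corner x)%:Z)%R 0%R
    (insub (inr (v, e) : vert G + vert G * edge G)).

Lemma corner_weight_ge0 v e : (0 <= corner_weight v e)%R.
Proof. by rewrite /corner_weight; case: insub. Qed.

Lemma corner_weight_sum v : v \in T ->
  (\sum_(e in incident v) corner_weight v e <= 1)%R.
Proof. by move=> vT; rewrite -(ti_sum_corners _ vT) odd_corner_sum. Qed.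

Definition ti_weight (lam : vert G -> int) (x : vert TI) : int :=
  match val x with inl v => lam v | inr _ => (odd_corner x)%:Z%R end.

Lemma ti_weight_at lam v e x : ti_at v e x ->
  ti_weight lam x = if v \in T then corner_weight v e else lam v.
Proof.
rewrite /ti_at /ti_weight => xE; rewrite xE; case: ifP => vT; rewrite vT in xE *;
  last by [].
by rewrite /corner_weight -xE valK.
Qed.

Lemma ti_weight_ends lam (e : edge G) :
  (\sum_(x in ends (inl e : edge TI)) ti_weight lam x =
   \sum_(v in ends e) if v \in T then corner_weight v e else lam v)%R.
Proof.
have [a [b [ab eab]]] := set2_ends e.
have [x ax] : exists x, ti_at a e x by apply: ti_at_exists; rewrite eab !inE eqxx.
have [y ay] : exists y, ti_at b e y by apply: ti_at_exists; rewrite eab !inE eqxx orbT.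
have [xy exy] := ti_ends_inl ab eab ax ay.
by rewrite (sum_ends _ ab eab) (sum_ends _ xy exy) (ti_weight_at _ ax) (ti_weight_at _ ay).
Qed.

Lemma ti_weight_triangle lam A :
  (((inr A : edge TI) \in cut X)%:Z =
   \sum_(x in ends (inr A : edge TI)) ti_weight lam x)%R.
Proof.
have [x [y [xy eE]]] := set2_ends (inr A : edge TI).
have xA : x \in val A by rewrite [val A]eE !inE eqxx.
have yA : y \in val A by rewrite [val A]eE !inE eqxx orbT.
have [v [vT xv Av _]] := ti_edge_corners xA; have yv := subsetP Av y yA.
rewrite (sum_ends _ xy eE) (in_cut _ xy eE).
have [e [h xE]] := in_corners xv; have [f [k yE]] := in_corners yv.
have := odd_corner_edge vT xv yv xy; rewrite /ti_weight xE yE /= => ->.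
by rewrite PoszD.
Qed.

Lemma ti_weight_total lam :
  (\sum_x ti_weight lam x = \sum_v if v \in T then
     \sum_(e in incident v) corner_weight v e else lam v)%R.
Proof.
rewrite (partition_big ti_proj predT) //=; apply: eq_bigr => v _.
case: ifPn => vT.
  rewrite -(ti_sum_corners _ vT); apply: eq_big => [x|x].
    apply/eqP/idP => [xv|/in_corners[e [h ->]] //].
    by rewrite -xv ti_proj_corner // xv.
  move=> /eqP xv; have : x \in ti_corners T v by rewrite -xv ti_proj_corner // xv.
  by case/in_corners => e [h ->].
rewrite (big_pred1 (exist _ (inl v) vT : vert TI)) // => -[[w|[w e]] Px] /=.
  by rewrite -val_eqE.
by rewrite -val_eqE /ti_proj /=; apply/eqP => wv; move: (Px); rewrite /= wv (negPf vT).
Qed.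

(** In the lift of F the cut indicator sums to 1, and the corner weights sum to their total because
    every vertex is covered once. Triangle edges cancel: there the indicator is the sum of the
    weights of the ends. *)
Lemma ti_tight_cut_factor : tight_cut X -> forall F, odd_factor T F ->
  (\sum_(e in F) (((inl e : edge TI) \in cut X)%:Z -
     \sum_(v in ends e) if v \in T then corner_weight v e else 0) =
   1 - \sum_x ti_weight (fun=> 0) x)%R.
Proof.
move=> tX F /(ti_lift_matching deg3) PM.
rewrite -(perfect_matching_sum _ PM).
rewrite -(tight_cut_sum PM tX) -sumrB big_sumType /= [X in (_ + X)%R]big1 => [|A _];
  last first.
  by rewrite (ti_weight_triangle (fun=> 0%R)) subrr.
rewrite addr0; apply: eq_big => [e|e _]; first by rewrite inE.
by rewrite (ti_weight_ends (fun=> 0%R)).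
Qed.

(** The total comes out before any sign is known, because nonnegativity of [lam] is later deduced
    from it. *)
Lemma ti_tight_cut_trivial lam : connected TI ->
  (exists M : {set edge TI}, perfect_matching M) -> tight_cut X ->
  (forall e : edge G, ((inl e : edge TI) \in cut X)%:Z =
     \sum_(v in ends e) if v \in T then corner_weight v e else lam v)%R ->
  (\sum_v (if v \in T then \sum_(e in incident v) corner_weight v e else lam v) = 1)%R /\
  ((forall v, v \notin T -> 0 <= lam v)%R -> trivial_cut X).
Proof.
move=> conn [M PM] tX lamE.
have gE e : ((e \in cut X)%:Z = \sum_(x in ends e) ti_weight lam x)%R.
  by case: e => [e|A]; [rewrite ti_weight_ends|exact: ti_weight_triangle].
split.
  rewrite -ti_weight_total -(perfect_matching_sum _ PM) -(eq_bigr _ (fun e _ => gE e)).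
  exact: tight_cut_sum.
move=> lam0; apply: (tight_cut_trivial conn _ tX gE); first by exists M.
move=> [[v|[v e]] Px]; rewrite /ti_weight //=; exact: lam0.
Qed.

End TightCut.
End TriangleInsertionBrick.

(** * Layered words *)

(* The presence of the edges u_s^1u_s^2, u_s^2u_s^3, u_s^3u_s^4 and of the edges
   leaving u_s^1 and u_s^4 for the next layer (for u if s = t), in this order. *)
Notation layer := (bool * bool * bool * bool * bool)%type.

Definition lay_p (l : layer) := l.1.1.1.1.
Definition lay_q (l : layer) := l.1.1.1.2.
Definition lay_r (l : layer) := l.1.1.2.
Definition lay_a (l : layer) := l.1.2.
Definition lay_b (l : layer) := l.2.

Arguments lay_a : simpl never.
Arguments lay_b : simpl never.

Definition layers : seq layer :=
  [seq (x, b) | x <- [seq (x, a) | x <- [seq (x, r) | x <- [seq (p, q) |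
     p <- [:: true; false], q <- [:: true; false]], r <- [:: true; false]],
     a <- [:: true; false]], b <- [:: true; false]].

Arguments layers : simpl never.

(* g, T2, T4 and Tu tell whether degree 3 is allowed at the vertices of S in
   general, at u_t^2, at u_t^4 and at u respectively. *)
Section Words.
Variables g T2 T4 Tu : bool.

(* ai and bi are the presence bits of the two edges entering the layer. *)
Definition layer_ok (first last ai bi : bool) (l : layer) : bool :=
  [&& (if first then ~~ (lay_p l && lay_a l) || g else lay_p l + lay_a l + ai == 1),
      (if first then ~~ (lay_q l && lay_r l) || g else lay_q l + lay_r l + bi == 1),
      ~~ (lay_p l && lay_q l) || (if last then T2 else g) &
      ~~ (lay_r l && lay_b l) || (if last then T4 else g)].

(* The number of edges from the layer to u', as forced by parity. *)
Definition layer_count (first : bool) (l : layer) : nat :=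
  (if first then (lay_p l == lay_a l) + (lay_q l == lay_r l) else 0) +
  (lay_p l == lay_q l) + (lay_r l == lay_b l).

(* n counts the edges at u' met so far. *)
Fixpoint valid (first : bool) (n : nat) (ai bi : bool) (w : seq layer) : bool :=
  match w with
  | [::] => (n + (ai == bi) == 1) && (~~ (ai && bi) || Tu)
  | l :: w' => [&& layer_ok first (nilp w') ai bi l, n + layer_count first l <= 1 &
                 valid false (n + layer_count first l) (lay_a l) (lay_b l) w']
  end.

Definition choices (first last : bool) (n : nat) (ai bi : bool) : seq layer :=
  [seq l <- layers | layer_ok first last ai bi l && (n + layer_count first l <= 1)].
Arguments choices : simpl never.

Fixpoint words (m : nat) (first : bool) (n : nat) (ai bi : bool) : seq (seq layer) :=
  match m with
  | 0 => if (n + (ai == bi) == 1) && (~~ (ai && bi) || Tu) then [:: [::]] else [::]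
  | m'.+1 => [seq l :: w |
      l <- choices first (m' == 0) n ai bi,
      w <- words m' false (n + layer_count first l) (lay_a l) (lay_b l)]
  end.

Lemma mem_layers l : l \in layers.
Proof. by case: l => -[[[[] []] []] []] []. Qed.

Lemma mem_words m first n ai bi w :
  (w \in words m first n ai bi) = (size w == m) && valid first n ai bi w.
Proof.
elim: m first n ai bi w => [|m IH] first n ai bi [|l w] //=; first by case: ifP.
- by case: ifP.
- by apply/negP => /allpairsPdep[? [? []]].
apply/allpairsPdep/idP => [[l' [w' [+ + [-> ->]]]]|].
  rewrite mem_filter IH => /andP[/andP[ok c] _] /andP[/eqP sw v].
  by rewrite eqSS sw eqxx c v /nilp sw ok.
rewrite eqSS => /and4P[/eqP sw ok c v]; exists l, w; split=> //.
  by rewrite mem_filter mem_layers c -sw ok.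
by rewrite IH sw eqxx v.
Qed.

Lemma uniq_words m first n ai bi : uniq (words m first n ai bi).
Proof.
elim: m first n ai bi => [|m IH] first n ai bi //=; first by case: ifP.
apply: allpairs_uniq_dep => [|l _|]; first by apply: filter_uniq; vm_compute.
  exact: IH.
by move=> [l w] [l' w'] _ _ /= [-> ->].
Qed.

Lemma size_wordsS m first n ai bi : size (words m.+1 first n ai bi) =
  sumn [seq size (words m false (n + layer_count first l) (lay_a l) (lay_b l))
         | l <- choices first (m == 0) n ai bi].
Proof. exact: size_allpairs_dep. Qed.

(* N and H precede the layer that contains the neighbour of u', X and Y follow
   it, and lay_V1, ..., lay_V9 below are that layer; as first layers, X and Y
   contain that neighbour themselves. *)
Definition lay_N : layer := (true, false, true, false, false).
Definition lay_H : layer := (false, true, false, true, true).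
Definition lay_X : layer := (false, true, false, false, true).
Definition lay_Y : layer := (true, false, false, false, true).

Lemma choices_10 last : choices false last 1 true false = [:: lay_X].
Proof. by rewrite /choices /layer_ok; case: last; case: g T2 T4 => [] [] [];
  vm_compute. Qed.

Lemma choices_01 last : choices false last 1 false true = [:: lay_Y].
Proof. by rewrite /choices /layer_ok; case: last; case: g T2 T4 => [] [] [];
  vm_compute. Qed.

(** With the edge at [u'] already used and a single bit entering, each layer is forced, and it
    passes on the pair of bits (0,1). *)
Lemma size_words_post m ai : size (words m false 1 ai (~~ ai)) = 1.
Proof.
elim: m ai => [|m IH] ai; first by case: ai.
by case: ai; rewrite size_wordsS ?choices_10 ?choices_01;
  apply: etrans (addn0 _) (IH false).
Qed.

(** The two entering edges already cover u_s^1 and u_s^3, so the path edges and the [a] edge are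
    absent. Parity then puts an edge to [u'] at u_s^2, and the [b] edge must be present lest u_s^4
    use a second one. *)
Lemma choices_11 last : choices false last 0 true true = [:: (false, false, false, false,
  true)].
Proof. by rewrite /choices /layer_ok; case: last; case: g T2 T4 => [] [] [];
  vm_compute. Qed.

Lemma size_words_11 m : size (words m.+1 false 0 true true) = 1.
Proof. by rewrite size_wordsS choices_11;
  apply: etrans (addn0 _) (size_words_post m false). Qed.

Definition lay_V1 : layer := (false, false, true, true, false).
Definition lay_V2 : layer := (true, true, false, false, true).
Definition lay_V3 : layer := (false, true, false, true, false).
Definition lay_V4 : layer := (true, false, true, false, true).

Lemma choices_00 : g -> choices false false 0 false false =
  [:: lay_V2; lay_V4; lay_N; lay_H; lay_V3; lay_V1].
Proof. by rewrite /choices /layer_ok => ->; vm_compute. Qed.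

(** Of the six layers available before the last one, [lay_N] returns to the same state and the other
    five have a unique continuation. In the last layer [lay_V2], [lay_V4] and [lay_H] are subject to
    [T2], [T4] and [Tu]. *)
Lemma size_words_00 m : g ->
  size (words m.+1 false 0 false false) = 5 * m + 3 + T2 + T4 + Tu.
Proof.
move=> gT; elim: m => [|m IH].
  rewrite size_wordsS /= (_ : choices _ _ _ _ _ =
     nseq T2 lay_V2 ++ nseq T4 lay_V4 ++ [:: lay_N; lay_H; lay_V3; lay_V1]).
    rewrite !map_cat !sumn_cat !map_nseq !sumn_nseq.
    set a := (X in X * _); set b := (X in _ + (X * _ + _)); set c := sumn _.
    have [-> [-> ->]] : a = 1 /\ b = 1 /\ c = 3 + Tu.
      by split; [|split]; rewrite /a /b /c /=; case: Tu.
    by rewrite !mul1n; lia.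
  by move: gT; rewrite /choices /layer_ok; case: g T2 T4 => [] [] []; vm_compute.
rewrite size_wordsS choices_00 //; move: (size_words_post m.+1) => h.
(* One summand per layer of [choices_00], in that order; the third belongs to [lay_N]. *)
transitivity (1 + (1 + (size (words m.+1 false 0 false false) + (1 + (1 + (1 + 0))))));
  last by rewrite IH; lia.
congr (_ + (_ + (_ + (_ + (_ + (_ + 0))))));
  [exact: (h false)|exact: (h false)|exact: size_words_11|exact: (h true)|exact: (h true)].
Qed.

Definition lay_V5 : layer := (false, false, false, false, true).
Definition lay_V7 : layer := (true, false, true, true, false).
Definition lay_V9 : layer := (false, true, true, true, false).

Lemma choices_first : g -> choices true false 0 false false =
  [:: lay_V2; lay_V7; lay_V4; lay_N; lay_Y; lay_V9; lay_H; lay_V3; lay_X; lay_V1].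
Proof. by rewrite /choices /layer_ok => ->; vm_compute. Qed.

(** In the first layer u_0^1 and u_0^3 are also joined to [u'], which raises the number of choices
    to ten: nine with a unique continuation, and [lay_N]. *)
Lemma size_words m : g ->
  size (words m.+2 true 0 false false) = 5 * m.+1 + 7 + T2 + T4 + Tu.
Proof.
move=> gT; rewrite size_wordsS choices_first //; move: (size_words_post m.+1) => h.
transitivity (1 + (1 + (1 + (size (words m.+1 false 0 false false) +
  (1 + (1 + (1 + (1 + (1 + (1 + 0)))))))))); last by rewrite size_words_00; lia.
congr (_ + (_ + (_ + (_ + (_ + (_ + (_ + (_ + (_ + (_ + 0))))))))));
  [exact: (h false)|exact: (h true)|exact: (h false)|exact: (h false)|exact: (h true)
  |exact: size_words_11|exact: (h true)|exact: (h false)|exact: (h true)].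
Qed.

(** With [tail10], the forced continuations counted by [size_words_post]. *)
Definition tail01 (m : nat) : seq layer := nseq m lay_Y.
Definition tail10 (m : nat) : seq layer :=
  if m is m'.+1 then lay_X :: nseq m' lay_Y else [::].

Lemma valid_tail01 m : valid false 1 false true (tail01 m).
Proof. by elim: m. Qed.

Lemma valid_tail10 m : valid false 1 true false (tail10 m).
Proof. by case: m => // m; apply: valid_tail01. Qed.

Lemma valid_nseq_N s w : valid (s == 0) 0 false false w ->
  valid true 0 false false (nseq s lay_N ++ w).
Proof. by case: s => [|s] // v; have {}v : valid false 0 false false w by []; elim: s. Qed.

Lemma nilp_tail01 s t : s <= t -> nilp (tail01 (t - s)) = (s == t).
Proof. by move=> st; rewrite /nilp size_nseq; lia. Qed.

Lemma nilp_tail10 s t : s <= t -> nilp (tail10 (t - s)) = (s == t).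
Proof.
move=> st; rewrite /nilp /tail10; case E : (t - s) => [|m] /=; lia.
Qed.

Lemma valid_10 t s l : s <= t -> layer_ok (s == 0) (s == t) false false l ->
  layer_count (s == 0) l = 1 -> lay_a l -> ~~ lay_b l ->
  valid true 0 false false (nseq s lay_N ++ l :: tail10 (t - s)).
Proof.
move=> st ok c al bl; apply: valid_nseq_N => /=.
by rewrite nilp_tail10 // ok c al (negPf bl) valid_tail10.
Qed.

Lemma valid_01 t s l : s <= t -> layer_ok (s == 0) (s == t) false false l ->
  layer_count (s == 0) l = 1 -> ~~ lay_a l -> lay_b l ->
  valid true 0 false false (nseq s lay_N ++ l :: tail01 (t - s)).
Proof.
move=> st ok c al bl; apply: valid_nseq_N => /=.
by rewrite nilp_tail01 // ok c bl (negPf al) valid_tail01.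
Qed.

Lemma valid_H t s : s < t ->
  valid true 0 false false (nseq s lay_N ++ lay_H :: lay_V5 :: tail01 (t - s.+1)).
Proof.
by move=> st; apply: valid_nseq_N; case: (s == 0); apply: valid_tail01.
Qed.

Lemma valid_N t : valid true 0 false false (nseq t lay_N).
Proof. by rewrite -[nseq _ _]cats0; apply: valid_nseq_N; case: (t == 0). Qed.

Lemma valid_NH t : Tu -> valid true 0 false false (nseq t lay_N ++ [:: lay_H]).
Proof. by move=> TuT; apply: valid_nseq_N; case: (t == 0); rewrite /= TuT. Qed.

End Words.

(** * Edge weights with constant sum on valid words come from a vertex potential *)

Section WordWeight.
Local Open Scope ring_scope.
Variables (gp gq gr ga gb gc2 gc4 : nat -> int) (gc1 gc3 gcu : int).

Definition layer_weight (s : nat) (l : layer) : int :=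
  (if lay_p l then gp s else 0) + (if lay_q l then gq s else 0) +
  (if lay_r l then gr s else 0) + (if lay_a l then ga s else 0) +
  (if lay_b l then gb s else 0) +
  (if lay_p l == lay_q l then gc2 s else 0) +
  (if lay_r l == lay_b l then gc4 s else 0) +
  (if s == 0%N then (if lay_p l == lay_a l then gc1 else 0) +
     (if lay_q l == lay_r l then gc3 else 0) else 0).

Ltac unfold_layers :=
  rewrite /layer_weight ?/lay_N ?/lay_H ?/lay_X ?/lay_Y ?/lay_V1 ?/lay_V2 ?/lay_V3
    ?/lay_V4 ?/lay_V5 ?/lay_V7 ?/lay_V9 /lay_p /lay_q /lay_r /lay_a /lay_b /=.

Fixpoint word_weight (s : nat) (ai bi : bool) (w : seq layer) : int :=
  match w with
  | [::] => if ai == bi then gcu else 0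
  | l :: w' => layer_weight s l + word_weight s.+1 (lay_a l) (lay_b l) w'
  end.

Variables (T2 T4 Tu : bool) (t : nat) (K : int).
Hypothesis t1 : (0 < t)%N.
Hypothesis wK : forall w, size w = t.+1 -> valid true T2 T4 Tu true 0 false false w ->
  word_weight 0 false false w = K.

(** The weight of a prefix of copies of [lay_N], which uses the first and third path edges and no
    edge at [u']. *)
Fixpoint prefix_weight (s : nat) : int :=
  if s is s'.+1 then prefix_weight s' + gp s' + gr s' else 0.

Let R01 (s : nat) : int := word_weight s false true (tail01 (t.+1 - s)).
Let R10 (s : nat) : int := word_weight s true false (tail10 (t.+1 - s)).
Let A := prefix_weight.

Lemma word_weight_N s w :
  word_weight 0 false false (nseq s lay_N ++ w) = A s + word_weight s false false w.
Proof.
suff h k : word_weight k false false (nseq s lay_N ++ w) =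
    (A (s + k) - A k) + word_weight (s + k) false false w.
  by rewrite h addn0 subr0.
elim: s k => [|s IH] k /=; first by rewrite subrr add0r.
rewrite IH addnS addSn /=; unfold_layers; case: (k == 0%N); lia.
Qed.

Lemma R01E s : (s < t)%N -> R01 s.+1 = gp s.+1 + gb s.+1 + R01 s.+2.
Proof.
move=> st; rewrite /R01 /tail01 !subSS -(subnSK st) /=; unfold_layers.
by set W := word_weight _ _ _ _; lia.
Qed.

Lemma R10E s : (s < t)%N -> R10 s.+1 = gq s.+1 + gb s.+1 + R01 s.+2.
Proof.
move=> st; rewrite /R01 /R10 /tail01 !subSS -(subnSK st) /=; unfold_layers.
by set W := word_weight _ _ _ _; lia.
Qed.

Lemma R01t : R01 t.+1 = 0. Proof. by rewrite /R01 subnn. Qed.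
Lemma R10t : R10 t.+1 = 0. Proof. by rewrite /R10 subnn. Qed.

Lemma size_tail01 m : size (tail01 m) = m. Proof. exact: size_nseq. Qed.
Lemma size_tail10 m : size (tail10 m) = m.
Proof. by case: m => //= m; rewrite size_nseq. Qed.

Lemma weight_exit10 s l : (s <= t)%N ->
  layer_ok true T2 T4 (s == 0%N) (s == t) false false l ->
  layer_count (s == 0%N) l = 1%N -> lay_a l -> ~~ lay_b l ->
  A s + layer_weight s l + R10 s.+1 = K.
Proof.
move=> st ok c al bl; rewrite -(wK _ (valid_10 Tu st ok c al bl)).
  by rewrite word_weight_N /= al (negPf bl) -addrA /R10 subSS.
by rewrite size_cat size_nseq /= size_tail10; lia.
Qed.

Lemma weight_exit01 s l : (s <= t)%N ->
  layer_ok true T2 T4 (s == 0%N) (s == t) false false l ->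
  layer_count (s == 0%N) l = 1%N -> ~~ lay_a l -> lay_b l ->
  A s + layer_weight s l + R01 s.+1 = K.
Proof.
move=> st ok c al bl; rewrite -(wK _ (valid_01 Tu st ok c al bl)).
  by rewrite word_weight_N /= bl (negPf al) -addrA /R01 subSS.
by rewrite size_cat size_nseq /= size_tail01; lia.
Qed.

Lemma weight_H s : (s < t)%N ->
  A s + gq s + ga s + gb s + gc2 s.+1 + gb s.+1 + R01 s.+2 = K.
Proof.
move=> st; rewrite -(wK _ (valid_H true T2 T4 Tu st)).
  rewrite word_weight_N /= /R01 !subSS; unfold_layers; set W := word_weight _ _ _ _;
    case: (s == 0%N); lia.
by rewrite size_cat size_nseq /= size_tail01; lia.
Qed.

Lemma weight_N : A t.+1 + gcu = K.
Proof.
rewrite -(wK _ (valid_N true T2 T4 Tu t.+1)) ?size_nseq //.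
by rewrite -[nseq _ _]cats0 word_weight_N.
Qed.

Lemma weight_V1 s : (s <= t)%N -> A s + gc2 s + gr s + ga s + R10 s.+1 = K.
Proof.
move=> st; rewrite -(@weight_exit10 s lay_V1) //; [|by case: (s == 0%N);
  case: (s == t)|by case: (s == 0%N)].
by unfold_layers; case: (s == 0%N); lia.
Qed.

Lemma weight_V3 s : (s <= t)%N -> A s + gc4 s + gq s + ga s + R10 s.+1 = K.
Proof.
move=> st; rewrite -(@weight_exit10 s lay_V3) //; [|by case: (s == 0%N);
  case: (s == t)|by case: (s == 0%N)].
by unfold_layers; case: (s == 0%N); lia.
Qed.

Lemma weight_V2 s : (s <= t)%N -> (s == t) ==> T2 ->
  A s + gc2 s + gp s + gq s + gb s + R01 s.+1 = K.
Proof.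
move=> st T2t; rewrite -(@weight_exit01 s lay_V2) //; [|by move: T2t; case: (s == 0%N);
  case: (s == t) => //= -> |by case: (s == 0%N)].
by unfold_layers; case: (s == 0%N); lia.
Qed.

Lemma weight_V4 s : (s <= t)%N -> (s == t) ==> T4 ->
  A s + gc4 s + gp s + gr s + gb s + R01 s.+1 = K.
Proof.
move=> st T4t; rewrite -(@weight_exit01 s lay_V4) //; [|by move: T4t; case: (s == 0%N);
  case: (s == t) => //= -> |by case: (s == 0%N)].
by unfold_layers; case: (s == 0%N); lia.
Qed.

Lemma t_neq0 : (0%N == t) = false. Proof. by case: t t1. Qed.

Lemma weight_X : gc1 + gq 0%N + gb 0%N + R01 1%N = K.
Proof. by rewrite -(@weight_exit01 0%N lay_X) //; unfold_layers; lia. Qed.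

Lemma weight_V7 : gc1 + gp 0%N + gr 0%N + ga 0%N + R10 1%N = K.
Proof. by rewrite -(@weight_exit10 0%N lay_V7) ?t_neq0 //; unfold_layers; lia. Qed.

Lemma weight_Y : gc3 + gp 0%N + gb 0%N + R01 1%N = K.
Proof. by rewrite -(@weight_exit01 0%N lay_Y) //; unfold_layers; lia. Qed.

Lemma weight_V9 : gc3 + gq 0%N + gr 0%N + ga 0%N + R10 1%N = K.
Proof. by rewrite -(@weight_exit10 0%N lay_V9) ?t_neq0 //; unfold_layers; lia. Qed.

Lemma weight_NH : Tu -> A t + gq t + ga t + gb t + gcu = K.
Proof.
move=> TuT; rewrite -(wK _ (valid_NH true T2 T4 t TuT)).
  by rewrite word_weight_N /=; unfold_layers; case: (t == 0%N); lia.
by rewrite size_cat size_nseq addn1.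
Qed.

(** [lay_V1] against [lay_V3] gives gc2 + gr = gc4 + gq, and [lay_V2] against [lay_V4] gives gc2 +
    gq = gc4 + gr; hence the two equalities. The formula for [ga] is [lay_V1] against [lay_V2]. *)
Lemma layer_lt s : (s < t)%N -> gq s = gr s /\ gc4 s = gc2 s /\
   ga s = gp s + gp s.+1 - gq s.+1 + gb s.
Proof.
move=> st; have st' := ltnW st; have st1 : (s == t) = false by lia.
have h1 := weight_V1 st'; have h3 := weight_V3 st'.
have h2 := @weight_V2 s st'; have h4 := @weight_V4 s st'; rewrite st1 in h2 h4.
have {}h2 := h2 isT; have {}h4 := h4 isT.
have h5 := @R01E s st; have h6 := @R10E s st; lia.
Qed.

(** [lay_H] at s against [lay_V2] at s+1 yields twice the equation gb s = gq (s+1); [lay_V2] at s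
    against [lay_V2] at s+1 then yields the one for [gc2]. The layer s+1 must not be the last, where
    [lay_V2] depends on [T2]. *)
Lemma layer_step s : (s.+1 < t)%N -> ga s = gp s + gp s.+1 /\ gb s = gq s.+1 /\
  gc2 s.+1 = gc2 s.
Proof.
move=> st; have st' := ltnW st.
have [h1 [h2 h3]] := layer_lt st'; have [h4 [h5 h6]] := layer_lt st.
have h7 := weight_H st'; have h8 := @weight_V2 s.+1 (ltnW st);
  have h9 := @weight_V2 s (ltnW st').
rewrite (_ : (s == t) = false) in h9; last by lia.
rewrite (_ : (s.+1 == t) = false) in h8; last by lia.
have {}h8 := h8 isT; have {}h9 := h9 isT.
have h10 := @R01E s st'; have h11 : A s.+1 = A s + gp s + gr s by [].
lia.
Qed.

Lemma gc2E s : (s < t)%N -> gc2 s = gc2 0%N.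
Proof.
elim: s => // s IH st; have [_ [_ ->]] := layer_step st; exact/IH/ltnW.
Qed.

(** [lay_X] against [lay_V2] gives gc1 = gc2 + gp, and [lay_V7] against [lay_V1] gives gc1 + gp =
    gc2, so gp vanishes. [lay_Y] and [lay_V9] do the same for [gc3] and [gq]. *)
Lemma layer0 : [/\ gp 0%N = 0, gq 0%N = 0, gr 0%N = 0, gc1 = gc2 0%N & gc3 = gc2 0%N].
Proof.
have [h1 [h2 h3]] := layer_lt t1.
have h4 := @weight_V2 0%N (ltnW t1); have h5 := @weight_V4 0%N (ltnW t1);
  rewrite t_neq0 in h4 h5.
have {}h4 := h4 isT; have {}h5 := h5 isT.
have h6 := weight_X; have h7 := weight_V7; have h8 := weight_Y; have h9 := weight_V9.
have h10 := weight_V1 (ltnW t1); have : A 0 = 0 by []; move=> h11.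
split; lia.
Qed.

(* The potentials of u_s^1, ..., u_s^4; that of u' is gc2 0. *)
Definition lam1 (s : nat) : int := if s is s'.+1 then ga s' - gp s' else 0.
Definition lam3 (s : nat) : int := if s is s'.+1 then gb s' else 0.
Definition lam2 (s : nat) : int := if s == t then gc2 t - gc2 0%N else 0.
Definition lam4 (s : nat) : int := if s == t then gc4 t - gc2 0%N else 0.

Lemma potential_lt s : (s < t)%N ->
  [/\ gp s = lam1 s, gq s = lam3 s, gr s = lam3 s, ga s = lam1 s + lam1 s.+1 &
      gb s = lam3 s.+1].
Proof.
case: s => [|s] st; rewrite /lam1 /lam3.
  have [h1 h2 h3 h4 h5] := layer0; split=> //; lia.
have [h1 [h2 h3]] := layer_step st; have [h4 [h5 h6]] := layer_lt st.
split; lia.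
Qed.

(** To be independent of the flags, only [lay_V1], [lay_V3] and the word of copies of [lay_N] are
    used at layer t, together with words that leave the prefix one layer earlier. This is enough
    because u_t^2, u_t^4 and u keep potentials of their own. *)
Lemma potential_t : [/\ gp t = lam1 t + lam2 t, gq t = lam2 t + lam3 t,
  gr t = lam3 t + lam4 t, ga t = lam1 t + (gcu - gc2 0%N) &
  gb t = lam4 t + (gcu - gc2 0%N)].
Proof.
rewrite /lam2 /lam4 eqxx; have tE : t = t.-1.+1 by case: t t1.
set s := t.-1 in tE; have st : (s < t)%N by rewrite tE.
have h1 := weight_V1 (leqnn t); have h2 := weight_V3 (leqnn t); have h3 := weight_H st.
have h4 := weight_N; have h5 := weight_V1 (ltnW st); have h6 := @weight_V2 s (ltnW st).
rewrite (_ : (s == t) = false) in h6; last by lia.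
have {}h6 := h6 isT; have h7 := gc2E st; have [h8 [h9 h10]] := layer_lt st.
have h11 := @R01E s st; have h12 := @R10E s st.
have h13 : A t = A s + gp s + gr s by rewrite tE.
have h14 : A t.+1 = A t + gp t + gr t by [].
have h15 : lam1 t = ga s - gp s by rewrite tE.
have h16 : lam3 t = gb s by rewrite tE.
have h17 := R01t; have h18 := R10t.
rewrite -tE in h3 h5 h6 h8 h9 h10 h11 h12.
split; lia.
Qed.

(** Each flag admits one more word, which has [lay_V2], [lay_V4] or [lay_H] as its last layer; its
    equation makes the corresponding potential vanish. *)
Lemma lam_T : [/\ T2 -> lam2 t = 0, T4 -> lam4 t = 0 & Tu -> gcu - gc2 0%N = 0].
Proof.
have [h1 h2 h3 h4 h5] := potential_t; have h6 := weight_N; have h7 := R01t.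
have h8 : lam2 t = gc2 t - gc2 0%N by rewrite /lam2 eqxx.
have h9 : lam4 t = gc4 t - gc2 0%N by rewrite /lam4 eqxx.
have h10 : A t.+1 = A t + gp t + gr t by [].
have h11 := weight_V1 (leqnn t); have h12 := R10t.
split=> Tt.
- have := @weight_V2 t (leqnn t); rewrite Tt implybT => /(_ isT); lia.
- have := @weight_V4 t (leqnn t); rewrite Tt implybT => /(_ isT); lia.
- have := weight_NH Tt; lia.
Qed.

Lemma potential_gc s : (s <= t)%N ->
  gc2 s = gc2 0%N + lam2 s /\ gc4 s = gc2 0%N + lam4 s.
Proof.
rewrite leq_eqVlt => /orP[/eqP->|st]; first by rewrite /lam2 /lam4 eqxx; split; lia.
have [_ [h _]] := layer_lt st; have h' := gc2E st.
by rewrite /lam2 /lam4 (_ : (s == t) = false); [split; lia|lia].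
Qed.

End WordWeight.

(** * Nonnegativity of the vertex weights *)

Section Positivity.
Local Open Scope ring_scope.

Definition bit01 (x : int) : Prop := 0 <= x <= 1.

(* The weight D at a vertex and its three parts along the incident edges: the
   parts are those of the three corners at a vertex of T, and all equal to D at
   a vertex outside T. *)
Definition split_weight (b : bool) (D y1 y2 y3 : int) : Prop :=
  if b then 0 <= y1 /\ 0 <= y2 /\ 0 <= y3 /\ D = y1 + y2 + y3 /\ D <= 1
  else y1 = D /\ y2 = D /\ y3 = D.

Variables (T2 T4 Tu : bool) (t : nat).
Variables (D1 D2 D3 D4 y1p y1a y1l y2p y2q y2c y3q y3r y3l y4r y4b y4c : nat -> int).
Variables (Du yua yub yuc c : int).
Hypothesis t1 : (0 < t)%N.
Hypothesis sp1 : forall s, (s <= t)%N ->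
  split_weight (s == 0%N) (D1 s) (y1p s) (y1a s) (y1l s).
Hypothesis sp3 : forall s, (s <= t)%N ->
  split_weight (s == 0%N) (D3 s) (y3q s) (y3r s) (y3l s).
Hypothesis sp2 : forall s, (s <= t)%N ->
  split_weight ((s == t) ==> T2) (D2 s) (y2p s) (y2q s) (y2c s).
Hypothesis sp4 : forall s, (s <= t)%N ->
  split_weight ((s == t) ==> T4) (D4 s) (y4r s) (y4b s) (y4c s).
Hypothesis spu : split_weight Tu Du yua yub yuc.
Hypothesis edge_pqr : forall s, (s <= t)%N ->
  [/\ bit01 (y1p s + y2p s), bit01 (y2q s + y3q s) & bit01 (y3r s + y4r s)].
Hypothesis edge_c : forall s, (s <= t)%N -> bit01 (c + y2c s) /\ bit01 (c + y4c s).
Hypothesis edge_ab : forall s, (s < t)%N ->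
  bit01 (y1a s + y1l s.+1) /\ bit01 (y4b s + y3l s.+1).
Hypothesis edge_abt : bit01 (y1a t + yua) /\ bit01 (y4b t + yub).
Hypothesis edge_c0 : [/\ bit01 (c + y1l 0%N), bit01 (c + y3l 0%N) & bit01 (c + yuc)].
Hypothesis total : c + Du + \sum_(s < t.+1) (D1 s + D2 s + D3 s + D4 s) = 1.

Let L (s : nat) : int := D1 s + D2 s + D3 s + D4 s.

Ltac layer s st :=
  have := sp1 (ltnW st); have := sp3 (ltnW st);
  have := sp2 (ltnW st); have := sp4 (ltnW st);
  have [] := edge_pqr (ltnW st); rewrite (_ : (s == t) = false) /=; last (by lia);
  rewrite /L /bit01 /split_weight.

(** Negative values of [D1] and [D3] are compensated by two different parts of [D2], those along the
    first and the second path edge. *)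
Lemma layer_sum_ge0 s : (s < t)%N -> 0 <= L s.
Proof. move=> st; layer s st; case: (s == 0%N); lia. Qed.

Lemma layer_sum_ge1_a s : (s < t)%N -> 1 <= y1a s -> 1 <= L s.
Proof. move=> st; layer s st; case: (s == 0%N); lia. Qed.

Lemma layer_sum_ge1_b s : (s < t)%N -> 1 <= y4b s -> 1 <= L s.
Proof. move=> st; layer s st; case: (s == 0%N); lia. Qed.

(** A negative weight at u_s^3 is compensated twice, by u_s^2 and by u_s^4. *)
Lemma layer_sum_ge1_3 s : (s < t)%N -> D3 s < 0 -> 1 <= L s.
Proof. move=> st; layer s st; case: (s == 0%N); lia. Qed.

Let Z : int := \sum_(s < t) L s.

Lemma layer_le_total i : (i < t)%N -> L i <= Z.
Proof.
move=> it; rewrite /Z (bigD1 (Ordinal it)) //= lerDl.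
by apply: sumr_ge0 => j _; apply: layer_sum_ge0.
Qed.

Lemma layers_le_total i j : (i < t)%N -> (j < t)%N -> i != j -> L i + L j <= Z.
Proof.
move=> it jt ij; rewrite /Z (bigD1 (Ordinal it)) //= (bigD1 (Ordinal jt)) /=; last first.
  by rewrite -val_eqE /= eq_sym.
by rewrite addrA lerDl; apply: sumr_ge0 => k _; apply: layer_sum_ge0.
Qed.

(** Below layer t all u_s^2 and u_s^4 are in T, which bounds each [L s] by itself. At layer t this
    depends on the flags, so that layer is estimated together with u and [u']. *)
Lemma total_split : c + Z + (L t + Du) = 1.
Proof. by move: total; rewrite big_ord_recr /= -/Z /L; lia. Qed.

Ltac last_layer :=
  have := sp1 (leqnn t); have := sp3 (leqnn t); have := sp2 (leqnn t);
  have := sp4 (leqnn t); have := spu; have [] := edge_pqr (leqnn t);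
  have [] := edge_c (leqnn t); have [] := edge_abt; have [_ _] := edge_c0;
  rewrite (_ : (t == 0%N) = false) ?eqxx /=; last (by lia);
  rewrite /L /bit01 /split_weight; case: T2; case: T4; case: Tu.

(** A negative weight at [u'] forces a part of at least 1 at each neighbour of [u']. The four
    vertices of layer 0 are such neighbours and lie in T, where weights are at most 1; so layer 0
    weighs 4, against c >= -1. *)
Lemma c_ge0 : 0 <= c.
Proof.
have h := total_split; have h0 := layer_le_total t1.
rewrite leNgt; apply/negP => c0.
have h1 : 4 <= L 0%N /\ -1 <= c.
  layer 0%N t1; have [] := edge_c (leq0n t); have [] := edge_c0; rewrite /bit01; lia.
have : 0 <= L t + Du by last_layer; lia.
lia.
Qed.

Lemma tail_ge0 : 0 <= c + (L t + Du).
Proof. have := c_ge0; last_layer; lia. Qed.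

Lemma tail_ge1 : 1 <= y1l t -> 1 <= c + (L t + Du).
Proof. have := c_ge0; last_layer; lia. Qed.

Lemma tail_ge1_1 : D1 t < 0 -> 1 <= c + (L t + Du).
Proof. have := c_ge0; last_layer; lia. Qed.

Lemma tail_ge1_3 : D3 t < 0 -> 1 <= c + (L t + Du).
Proof. have := c_ge0; last_layer; lia. Qed.

(** Such a vertex is outside T, so its weight counts on all three of its edges, and each of its
    neighbours, [u'] among them, has to compensate it. *)
Lemma tail_ge2 : D2 t < 0 \/ D4 t < 0 \/ Du < 0 -> 2 <= c + (L t + Du).
Proof. have := c_ge0; last_layer; lia. Qed.

(** A negative weight at u_s^1 has to be compensated along both [a] edges, in the layers s-1 and s+1
    or in the final group. Two disjoint groups then weigh at least 1 each, and the rest is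
    nonnegative, against the total 1. *)
Lemma D1_ge0 s : (s <= t)%N -> 0 <= D1 s.
Proof.
move=> st; rewrite leNgt; apply/negP => D0.
have h1 := sp1 st; rewrite /split_weight in h1.
case: s st D0 h1 => [|s] st D0 h1; first by move: h1 => /=; lia.
have {}h1 : y1a s.+1 = D1 s.+1 /\ y1l s.+1 = D1 s.+1 by move: h1 => /=; lia.
have [h2 _] := edge_ab st.
have h3 : 1 <= L s by apply: layer_sum_ge1_a => //; move: h2; rewrite /bit01; lia.
have h4 := total_split; have h5 := tail_ge0; have h6 := layer_le_total st.
have [st1|st1] := leqP t s.+1.
  have tE : t = s.+1 by lia.
  by rewrite -tE in D0; have := tail_ge1_1 D0; lia.
have [h7 _] := edge_ab st1; have h8 := sp1 st1; rewrite /split_weight /= in h8.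
have {}h7 : 1 <= y1l s.+2 by move: h7; rewrite /bit01; lia.
have [st2|st2] := leqP t s.+2.
  have tE : t = s.+2 by lia.
  by rewrite -tE in h7; have := tail_ge1 h7; lia.
have h9 : 1 <= L s.+2 by apply: layer_sum_ge1_a => //; lia.
have : s != s.+2 by lia.
by move=> /(layers_le_total st st2); lia.
Qed.

(** Here the two heavy groups are the preceding layer, reached along the [b] edge, and the layer of
    the vertex itself (or the final group). *)
Lemma D3_ge0 s : (s <= t)%N -> 0 <= D3 s.
Proof.
move=> st; rewrite leNgt; apply/negP => D0.
have h1 := sp3 st; rewrite /split_weight in h1.
case: s st D0 h1 => [|s] st D0 h1; first by move: h1 => /=; lia.
have {}h1 : y3l s.+1 = D3 s.+1 by move: h1 => /=; lia.
have [_ h2] := edge_ab st.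
have h3 : 1 <= L s by apply: layer_sum_ge1_b => //; move: h2; rewrite /bit01; lia.
have h4 := total_split; have h5 := tail_ge0; have h6 := layer_le_total st.
have [st1|st1] := leqP t s.+1.
  have tE : t = s.+1 by lia.
  by rewrite -tE in D0; have := tail_ge1_3 D0; lia.
have h9 := layer_sum_ge1_3 st1 D0.
have : s != s.+1 by lia.
by move=> /(layers_le_total st st1); lia.
Qed.

Lemma D24_ge0 s : (s <= t)%N -> 0 <= D2 s /\ 0 <= D4 s.
Proof.
move=> st; have := sp2 st; have := sp4 st; rewrite /split_weight.
have [tE|ts] := eqVneq s t; last by rewrite /=; lia.
rewrite tE => _ _; have h1 := tail_ge2; have h2 := total_split;
  have h3 := layer_le_total t1.
have := layer_sum_ge0 t1; lia.
Qed.

Lemma Du_ge0 : 0 <= Du.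
Proof.
have h1 := tail_ge2; have h2 := total_split; have h3 := layer_le_total t1.
have := layer_sum_ge0 t1; lia.
Qed.

End Positivity.

(** * The graphs G_t and G'_t *)

Section Ladder.
Variable t : nat.

Definition Vt (s j : nat) : vert (Gt t) := Some (inord s, inord j).

(* The vertex u is coded as u_(t+1)^1 would be. *)
Definition code (v : vert (Gt t)) : nat :=
  if v is Some (s, j) then 4 * s + j else 4 * t.+1.

Lemma code_V s j : s <= t -> j < 4 -> code (Vt s j) = 4 * s + j.
Proof. by move=> st j4; rewrite /code /= !inordK. Qed.

Lemma code_inj : injective code.
Proof.
move=> [[s j]|] [[s' j']|] //=; rewrite /code => h.
- have := ltn_ord j; have := ltn_ord j' => j4 j4'.
  have [/val_inj-> /val_inj->] : s = s' :> nat /\ j = j' :> nat by lia.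
  by [].
- by have := ltn_ord s; have := ltn_ord j; lia.
- by have := ltn_ord s'; have := ltn_ord j'; lia.
Qed.

Lemma VtP (v : vert (Gt t)) :
  v = uu t \/ exists s j, [/\ s <= t, j < 4 & v = Vt s j].
Proof.
case: v => [[s j]|]; [right|by left].
by exists s, j; rewrite -ltnS !ltn_ord /Vt !inord_val.
Qed.

(* kL s k and kR s k are the ends of the k-th edge of layer s, in the order of
   the bits of a layer; cL and cR are their codes. *)
Definition kL (s k : nat) : vert (Gt t) := Vt s (nth 3 [:: 0; 1; 2; 0] k).

Definition kR (s k : nat) : vert (Gt t) :=
  match k with
  | 0 => Vt s 1
  | 1 => Vt s 2
  | 2 => Vt s 3
  | 3 => if s < t then Vt s.+1 0 else uu t
  | _ => if s < t then Vt s.+1 2 else uu t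
  end.

Definition cL (s k : nat) : nat := 4 * s + nth 3 [:: 0; 1; 2; 0] k.
Definition cR (s k : nat) : nat :=
  4 * s + match k with 0 => 1 | 1 => 2 | 2 => 3 | 3 => 4 | _ => if s < t then 6 else 4 end.

Lemma code_kL s k : s <= t -> k < 5 -> code (kL s k) = cL s k.
Proof. by move=> st k5; rewrite code_V //; case: k k5 => [|[|[|[|[|]]]]]. Qed.

Lemma code_kR s k : s <= t -> k < 5 -> code (kR s k) = cR s k.
Proof.
move=> st; case: k => [|[|[|[|[|]]]]] // _; rewrite /cR /kR ?code_V //.
  by case: (ltnP s t) => ts; [rewrite code_V //=; lia|rewrite /code /=; lia].
by case: (ltnP s t) => ts; [rewrite code_V //=; lia|rewrite /code /=; lia].
Qed.

Lemma kLR_edge s k : s <= t -> k < 5 ->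
  [exists x, exists y, [&& x != y, @Gt_rel t x y & [set kL s k; kR s k] == [set x; y]]].
Proof.
move=> st k5.
have ne : kL s k != kR s k.
  apply/eqP => /(congr1 code); rewrite code_kL // code_kR // /cL /cR.
  by case: k k5 => [|[|[|[|[|]]]]] //= _; case: (ltnP s t) => _; lia.
have [r|r] : @Gt_rel t (kL s k) (kR s k) \/ @Gt_rel t (kR s k) (kL s k).
- case: k k5 ne => [|[|[|[|[|]]]]] //= _ ne; rewrite /kL /kR /=.
  + by left; rewrite /= eqxx !inordK.
  + by left; rewrite /= eqxx !inordK.
  + by left; rewrite /= eqxx !inordK.
  + case: (ltnP s t) => ts; [left|right]; rewrite /= ?inordK //; last by lia.
    by rewrite eqxx /= orbT.
  + case: (ltnP s t) => ts; [left|right]; rewrite /= ?inordK //; last by lia.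
    by rewrite eqxx /= orbT.
- by apply/existsP; exists (kL s k); apply/existsP; exists (kR s k); rewrite ne r eqxx.
- apply/existsP; exists (kR s k); apply/existsP; exists (kL s k).
  by rewrite eq_sym ne r setUC eqxx.
Qed.

(** A default for [insubd]: [kE s k] is the intended edge for [s <= t] and [k < 5]. *)
Definition edge0 : edge (Gt t) := exist _ [set kL 0 0;
  kR 0 0] (@kLR_edge 0 0 (leq0n t) isT).

Definition kE (s k : nat) : edge (Gt t) := insubd edge0 [set kL s k; kR s k].

Lemma ends_kE s k : s <= t -> k < 5 -> ends (kE s k) = [set kL s k; kR s k].
Proof. by move=> st k5; rewrite [LHS]val_insubd kLR_edge. Qed.

Lemma in_kE v s k : s <= t -> k < 5 ->
  (v \in ends (kE s k)) = (code v == cL s k) || (code v == cR s k).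
Proof.
move=> st k5; rewrite ends_kE // !inE -!(inj_eq code_inj).
by rewrite code_kL // code_kR.
Qed.

Lemma kE_inj s k s' k' : s <= t -> k < 5 -> s' <= t -> k' < 5 ->
  (kE s k == kE s' k') = (s == s') && (k == k').
Proof.
move=> st k5 st' k5'; apply/eqP/andP => [E|[/eqP-> /eqP->]] //.
have h v : (code v == cL s k) || (code v == cR s k) =
           (code v == cL s' k') || (code v == cR s' k').
  by rewrite -!in_kE // E.
have := h (kL s k); have := h (kR s k); have := h (kL s' k'); have := h (kR s' k').
rewrite !code_kL // !code_kR // !eqxx !orbT /= => h1 h2 h3 h4.
move: h1 h2 h3 h4; rewrite /cL /cR {h E}.
by move: k k' k5 k5' => [|[|[|[|[|]]]]] // [|[|[|[|[|]]]]] //= _ _; case: (ltnP s t) => ?;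
  case: (ltnP s' t) => ? h1 h2 h3 h4; split; lia.
Qed.

Lemma kE_surj (e : edge (Gt t)) : exists s k, [/\ s <= t, k < 5 & e = kE s k].
Proof.
have mk x y s k : s <= t -> k < 5 -> val e = [set x; y] ->
    (code x = cL s k /\ code y = cR s k) \/ (code y = cL s k /\ code x = cR s k) ->
    exists s k, [/\ s <= t, k < 5 & e = kE s k].
  move=> st k5 eE h; exists s, k; split=> //; apply: val_inj.
  have -> : val (kE s k) = [set kL s k; kR s k] by rewrite -ends_kE.
  rewrite eE; case: h; rewrite -code_kL // -code_kR // => -[/code_inj-> /code_inj->] //.
  by rewrite setUC.
have /existsP[x /existsP[y /and3P[_ r /eqP eE]]] := valP e.
case: x y r eE => [[s j]|] [[s' j']|] //=.
- have := ltn_ord s; have := ltn_ord s' => st' st; have := ltn_ord j;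
  have := ltn_ord j' => j4' j4.
  move=> /orP[/andP[/eqP ss /eqP jj]|/andP[/eqP ss /orP[/andP[/eqP j0 /eqP j'0]|/andP[/eqP
    j0 /eqP j'0]]]] eE.
  + apply: (mk _ _ s j _ _ eE); [lia|lia|left; rewrite /code /cL /cR -ss jj].
    have j3 : j < 3 by lia.
    by move: (nat_of_ord j) j3 => [|[|[|]]] //= _; split; lia.
  + by apply: (mk _ _ s 3 _ _ eE); [lia| |left; rewrite /code /cL /cR ss j0 j'0 /=; split;
    lia].
  + apply: (mk _ _ s 4 _ _ eE); [lia|by []|left; rewrite /code /cL /cR ss j0 j'0 /=].
    have st1 : s < t by lia.
    by rewrite st1; split; lia.
- have := ltn_ord s'; have := ltn_ord j' => j4' st'.
  move=> /andP[/eqP ss /orP[/eqP j0|/eqP j0]] eE.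
  + by apply: (mk _ _ s' 3 _ _ eE); [lia| |right; rewrite /code /cL /cR ss j0 /=; split;
    lia].
  + apply: (mk _ _ s' 4 _ _ eE); [lia|by []|right; rewrite /code /cL /cR ss j0 /= ltnn].
    by split; lia.
Qed.

Lemma mem_Sset (v : vert (Gt t)) :
  (v \in Sset t) = if v is Some (s, j) then odd j || (s == 0 :> nat) else true.
Proof.
rewrite /Sset !inE; case: v => [[s j]|]; last by rewrite eqxx !orbT.
have -> : (Some (s, j) \in [set u_ t (nat_of_ord s0) 2 | s0 : 'I_t.+1]) = (j == 1 :> nat).
  apply/imsetP/eqP => [[s0 _ [_ ->]]|j1]; first by rewrite inordK.
  by exists s => //; rewrite /u_ inord_val; congr (Some (_, _)); apply: val_inj;
    rewrite /= inordK.
have -> : (Some (s, j) \in [set u_ t (nat_of_ord s0) 4 | s0 : 'I_t.+1]) = (j == 3 :> nat).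
  apply/imsetP/eqP => [[s0 _ [_ ->]]|j1]; first by rewrite inordK.
  by exists s => //; rewrite /u_ inord_val; congr (Some (_, _)); apply: val_inj;
    rewrite /= inordK.
have eqV k : k < 4 -> (Some (s, j) == u_ t 0 k.+1) = (s == 0 :> nat) && (j == k :> nat).
  by move=> k4; rewrite -(inj_eq code_inj) /u_ /code /= !inordK //; have := ltn_ord j; lia.
rewrite !eqV //= orbF; have := ltn_ord j.
by move: (nat_of_ord j) (nat_of_ord s) => [|[|[|[|]]]] //= [].
Qed.

Lemma mem_Sset_V s j : s <= t -> j < 4 -> (Vt s j \in Sset t) = odd j || (s == 0).
Proof. by move=> st j4; rewrite mem_Sset /= !inordK. Qed.

Lemma uu_Sset : uu t \in Sset t. Proof. by rewrite mem_Sset. Qed.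

Definition spoke0 : {v : vert (Gt t) | v \in Sset t} := exist _ (uu t) uu_Sset.

(** Total in [v], to avoid carrying membership proofs; it is the edge from [u'] to [v] when [v] lies
    in [Sset t]. *)
Definition cE (v : vert (Gt t)) : edge (Gt' t) := inr (insubd spoke0 v).

Lemma cE_val (v : vert (Gt t)) (w : {v : vert (Gt t) | v \in Sset t}) : v \in Sset t ->
  ((inr w : edge (Gt' t)) == cE v) = (val w == v).
Proof.
move=> vS; rewrite [LHS](_ : _ = (w == insubd spoke0 v)) //.
by rewrite -val_eqE val_insubd vS.
Qed.

Lemma inr_cE (w : {v : vert (Gt t) | v \in Sset t}) : inr w = cE (val w).
Proof. by apply/eqP; rewrite cE_val // (valP w). Qed.

Lemma big_edges (h : edge (Gt' t) -> int) :
  (\sum_e h e = \sum_(s < t.+1) (h (inl (kE s 0)) + h (inl (kE s 1)) + h (inl (kE s 2))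
     + h (inl (kE s 3)) + h (inl (kE s 4))) + \sum_(v in Sset t) h (cE v))%R.
Proof.
rewrite big_sumType /=; congr (_ + _)%R.
  pose f (x : 'I_t.+1 * 'I_5) := kE x.1 x.2.
  rewrite (eq_bigl (fun e => e \in [set f x | x : 'I_t.+1 * 'I_5])) => [|e]; last first.
    have [s [k [st k5 ->]]] := kE_surj e; apply/esym/imsetP.
    by exists (Ordinal (st : s < t.+1), Ordinal k5).
  rewrite big_imset /= => [|[s k] [s' k'] _ _ /eqP]; last first.
    rewrite /f /= kE_inj ?ltn_ord ?leq_ord // => /andP[/eqP ss /eqP kk].
    by congr (_, _); apply: val_inj.
  rewrite (eq_bigl predT) => [|x]; last by rewrite inE.
  rewrite -(pair_bigA _ (fun (s : 'I_t.+1) (k : 'I_5) => h (inl (kE s k)))) /=.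
  by apply: eq_bigr => s _; rewrite !big_ord_recl big_ord0 /= addr0 !addrA.
rewrite (eq_bigr (fun w => h (cE (val w)))) => [|w _]; last by rewrite -inr_cE.
rewrite -(big_imset (h \o cE)) /= => [|x y _ _]; last exact: val_inj.
apply: eq_bigl => v; apply/imsetP/idP => [[w _ ->]|vS]; first exact: valP.
by exists (exist _ v vS).
Qed.

Lemma big_Sset (h : vert (Gt t) -> int) :
  (\sum_(v in Sset t) h v = \sum_(s < t.+1) (h (Vt s 1) + h (Vt s 3)) +
     (h (Vt 0 0) + h (Vt 0 2) + h (uu t)))%R.
Proof.
rewrite (bigD1 (uu t)) ?uu_Sset //=.
pose f (x : 'I_t.+1 * 'I_4) : vert (Gt t) := Some x.
rewrite (eq_bigl (fun v => v \in [set f x | x : 'I_t.+1 * 'I_4 & odd x.2 || (x.1 == 0 :>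
  nat)])); last first.
  move=> v; rewrite mem_Sset; apply/andP/imsetP => [[+ vu]|[[s j] + ->]].
    case: v vu => [[s j]|//] _ h'; exists (s, j) => //; rewrite inE //.
  by rewrite inE.
rewrite big_imset /= => [|x y _ _ []] //.
rewrite (eq_bigl (fun x : 'I_t.+1 * 'I_4 => odd x.2 || (x.1 == 0 :> nat))) => [|x];
  last by rewrite inE.
rewrite big_mkcond /= (eq_bigr (fun p : 'I_t.+1 * 'I_4 =>
  if odd p.2 || (p.1 == 0 :> nat) then h (f (p.1, p.2)) else 0%R)) => [|[] //].
rewrite -(pair_bigA _ (fun (s : 'I_t.+1) (k : 'I_4) => if odd k || (s == 0 :> nat) then h
  (f (s, k)) else 0%R)) /=.
under eq_bigr => s _ do rewrite !big_ord_recl big_ord0 /= addr0.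
have fE (s : 'I_t.+1) (k : 'I_4) : f (s, k) = Vt s k by rewrite /Vt !inord_val.
rewrite (eq_bigr (fun s : 'I_t.+1 => (h (Vt s 1) + h (Vt s 3)) +
   (if s == ord0 then h (Vt 0 0) + h (Vt 0 2) else 0))%R) => [|s _]; last first.
  rewrite !fE /= /bump !leq0n !add1n -[s == ord0]val_eqE /=; case: eqP => [->|_] /=; lia.
by rewrite big_split /= -big_mkcond big_pred1_eq [LHS]addrC -!addrA.
Qed.

Lemma card_Sset : #|Sset t| = 2 * t + 5.
Proof.
have := big_Sset (fun=> 1%R); rewrite !sumr_const card_ord; lia.
Qed.

Lemma card_edge_Gt' : #|edge (Gt' t)| = 7 * t + 10.
Proof.
have := big_edges (fun=> 1%R); rewrite !sumr_const card_Sset card_ord.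
by rewrite -[#|_|]/#|edge (Gt' t)|; set n := #|_|; lia.
Qed.

End Ladder.

(** * Validity and weight of a word, layer by layer *)

Section ValidIndex.
Variables g T2 T4 Tu : bool.

Definition lay0 : layer := (false, false, false, false, false).

Definition lay_prev (f : layer -> bool) (b : bool) (w : seq layer) (s : nat) : bool :=
  if s is s'.+1 then f (nth lay0 w s') else b.

Lemma lay_prev_cons f b l w s : lay_prev f b (l :: w) s.+1 = lay_prev f (f l) w s.
Proof. by case: s. Qed.

(** The recursive form serves the count; the indexed form can be compared with the degrees at the
    vertices of each layer. [lay_prev] supplies the bits that enter a layer. *)
Lemma validP first n ai bi w :
  valid g T2 T4 Tu first n ai bi w <->
  [/\ forall s, s < size w -> layer_ok g T2 T4 (first && (s == 0)) (s.+1 == size w)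
        (lay_prev lay_a ai w s) (lay_prev lay_b bi w s) (nth lay0 w s),
      n + \sum_(s < size w) layer_count (first && (s == 0 :> nat)) (nth lay0 w s)
        + (lay_prev lay_a ai w (size w) == lay_prev lay_b bi w (size w)) = 1 &
      ~~ (lay_prev lay_a ai w (size w) && lay_prev lay_b bi w (size w)) || Tu].
Proof.
elim: w first n ai bi => [|l w IH] first n ai bi.
  rewrite /= big_ord0 addn0; split=> [/andP[/eqP h1 h2]|[_ h1 h2]] //.
  by rewrite h1 eqxx.
have ok0 : layer_ok g T2 T4 first (nilp w) ai bi l =
    layer_ok g T2 T4 (first && (0 == 0)) (1 == (size w).+1) ai bi l.
  by rewrite eqxx andbT eqSS eq_sym.
rewrite big_ord_recl [size _]/= !lay_prev_cons.
have -> : layer_count (first && (@ord0 (size w) == 0 :> nat))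
    (nth lay0 (l :: w) (@ord0 (size w))) =
    layer_count first l by rewrite andbT.
have -> : \sum_(i < size w) layer_count (first && (lift ord0 i == 0 :> nat))
      (nth lay0 (l :: w) (lift ord0 i)) =
    \sum_(s < size w) layer_count (false && (s == 0 :> nat)) (nth lay0 w s).
  by apply: eq_bigr => s _; rewrite andbF.
rewrite [valid _ _ _ _ _ _ _ _ _]/=.
have IHl := IH false (n + layer_count first l) (lay_a l) (lay_b l).
move: IHl; set S := \sum_(_ < _) _; set k := layer_count _ _; move=> {}IH.
split=> [/and3P[ok kn /IH[h1 h2 h3]]|[h1 h2 h3]].
  split=> [[|s] sw||//]; first by move: ok; rewrite ok0.
    by rewrite !lay_prev_cons andbF; apply: (h1 s sw).
  by rewrite addnA.
apply/and3P; split; first by rewrite ok0; apply: (h1 0).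
  by move: h2; lia.
apply/IH; split=> [s sw||//]; last by rewrite -h2 addnA.
by have := h1 s.+1 sw; rewrite !lay_prev_cons andbF.
Qed.

Lemma word_weightE gp gq gr ga gb gc2 gc4 gc1 gc3 gcu s ai bi w :
  (word_weight gp gq gr ga gb gc2 gc4 gc1 gc3 gcu s ai bi w =
   \sum_(i < size w) layer_weight gp gq gr ga gb gc2 gc4 gc1 gc3 (s + i) (nth lay0 w i)
   + if lay_prev lay_a ai w (size w) == lay_prev lay_b bi w (size w) then gcu else 0)%R.
Proof.
elim: w s ai bi => [|l w IH] s ai bi; first by rewrite big_ord0 add0r.
rewrite [size _]/= big_ord_recl !lay_prev_cons /= IH addn0 [LHS]addrA; congr (_ + _ + _)%R.
by apply: eq_bigr => i _; rewrite addSnnS.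
Qed.

End ValidIndex.

(** * Incidence in G'_t *)

Lemma incident_card (G : mgraph) (v : vert G) (r : seq (edge G)) :
  uniq r -> (forall e, (v \in ends e) = (e \in r)) ->
  forall F : {set edge G}, #|F :&: incident v| = \sum_(e <- r) (e \in F).
Proof.
move=> ur vr F; rewrite setIC -sum_nat_mem big_uniq //=.
by apply: eq_bigl => e; rewrite inE vr.
Qed.

Lemma incident_sum (G : mgraph) (v : vert G) (r : seq (edge G)) :
  uniq r -> (forall e, (v \in ends e) = (e \in r)) ->
  forall h : edge G -> int, (\sum_(e in incident v) h e = \sum_(e <- r) h e)%R.
Proof.
move=> ur vr F; rewrite big_uniq //=.
by apply: eq_bigl => e; rewrite inE vr.
Qed.

(* Stated for an abstract type of edges: deciding equality of the concrete edges
   by conversion is expensive. *)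
Section IncidenceList.
Variables (t : nat) (E : eqType) (ke : nat -> nat -> E) (c00 c02 : E) (c1 c3 : nat -> E).
Hypothesis ke_eq : forall s k s' k', s <= t -> k < 5 -> s' <= t -> k' < 5 ->
  (ke s k == ke s' k') = (s == s') && (k == k').
Hypothesis ke_c00 : forall s k, (ke s k == c00) = false.
Hypothesis ke_c02 : forall s k, (ke s k == c02) = false.
Hypothesis ke_c1 : forall s k s', (ke s k == c1 s') = false.
Hypothesis ke_c3 : forall s k s', (ke s k == c3 s') = false.

Definition inc_seq (s j : nat) : seq E :=
  match j with
  | 0 => [:: ke s 0; ke s 3; if s is s'.+1 then ke s' 3 else c00]
  | 1 => [:: ke s 0; ke s 1; c1 s]
  | 2 => [:: ke s 1; ke s 2; if s is s'.+1 then ke s' 4 else c02]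
  | _ => [:: ke s 2; ke s 4; c3 s]
  end.

Lemma uniq_inc_seq s j : s <= t -> uniq (inc_seq s j).
Proof.
move=> st; case: j s st => [|[|[|j]]] [|s] st;
  rewrite /inc_seq /= !inE ?ke_c00 ?ke_c02 ?ke_c1 ?ke_c3 ?ke_eq //=; lia.
Qed.

Lemma uniq_incu_seq (cu : E) : (forall s k, (ke s k == cu) = false) ->
  uniq [:: ke t 3; ke t 4; cu].
Proof. by move=> ke_cu; rewrite /= !inE !ke_cu ke_eq // andbF. Qed.

Lemma in_inc_seq s j s' k : s <= t -> j < 4 -> s' <= t -> k < 5 ->
  (ke s' k \in inc_seq s j) = (4 * s + j == cL s' k) || (4 * s + j == cR t s' k).
Proof.
move=> st j4 st' k5; rewrite /cL /cR.
move: j j4 s st => [|[|[|[|]]]] // _ [|s] st;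
  rewrite /inc_seq !inE ?ke_c00 ?ke_c02 ?ke_c1 ?ke_c3 ?orbF ?ke_eq //; try (by lia);
  move: k k5 => [|[|[|[|[|]]]]] //= _; try (by lia); by case: (ltnP s' t) => ?; lia.
Qed.

Lemma in_inc_seq_c x s j : (forall s k, (x == ke s k) = false) ->
  (x \in inc_seq s j) = match j with
    | 0 => (s == 0) && (x == c00) | 1 => x == c1 s
    | 2 => (s == 0) && (x == c02) | _ => x == c3 s end.
Proof.
by move=> xk; case: j => [|[|[|j]]]; case: s => [|s]; rewrite /inc_seq !inE ?xk.
Qed.

Lemma in_incu_seq (cu : E) s' k : (forall s k, (ke s k == cu) = false) ->
  s' <= t -> k < 5 -> (ke s' k \in [:: ke t 3; ke t 4; cu]) =
  (4 * t.+1 == cL s' k) || (4 * t.+1 == cR t s' k).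
Proof.
move=> ke_cu st' k5; rewrite !inE ke_cu orbF !ke_eq // /cL /cR.
move: k k5 => [|[|[|[|[|]]]]] //= _; try (by lia).
by case: (ltnP s' t) => ?; lia.
Qed.

End IncidenceList.

Section Ladder.
Variable t : nat.

Definition ladder_edge (s k : nat) : edge (Gt' t) := inl (kE t s k).
Local Notation ke := ladder_edge.

Lemma ke_eq s k s' k' : s <= t -> k < 5 -> s' <= t -> k' < 5 ->
  (ke s k == ke s' k') = (s == s') && (k == k').
Proof. by move=> *; rewrite -(@kE_inj t). Qed.

Lemma cE_eq v w : v \in Sset t -> w \in Sset t -> (cE v == cE w) = (v == w).
Proof. by move=> vS wS; rewrite cE_val // val_insubd vS. Qed.

Lemma cE_ke s k v : (cE v == ke s k) = false. Proof. by []. Qed.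

Lemma in_ends_ke v s k : s <= t -> k < 5 ->
  (Some v \in ends (ke s k)) = (code v == cL s k) || (code v == cR t s k).
Proof.
by move=> st k5; rewrite -in_kE // [LHS]mem_imset // => x y [].
Qed.

Lemma ends_cE v : v \in Sset t -> ends (cE v) = [set None; Some v].
Proof. by move=> vS; rewrite /= val_insubd vS. Qed.

Lemma in_ends_cE v w : w \in Sset t -> (Some v \in ends (cE w)) = (v == w).
Proof. by move=> wS; rewrite ends_cE // !inE. Qed.

Lemma edgeP (e : edge (Gt' t)) :
  (exists s k, [/\ s <= t, k < 5 & e = ke s k]) \/
  (exists2 v, v \in Sset t & e = cE v).
Proof.
case: e => [e|w]; [left|right].
  by have [s [k [st k5 ->]]] := kE_surj e; exists s, k.
by exists (val w); [apply: valP|apply: inr_cE].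
Qed.

Definition inc (s j : nat) : seq (edge (Gt' t)) :=
  inc_seq ke (cE (Vt t 0 0)) (cE (Vt t 0 2)) (fun s => cE (Vt t s 1))
    (fun s => cE (Vt t s 3)) s j.

Definition incu : seq (edge (Gt' t)) := [:: ke t 3; ke t 4; cE (uu t)].

Lemma uniq_inc s j : s <= t -> uniq (inc s j).
Proof. by apply: uniq_inc_seq => //; apply: ke_eq. Qed.

Lemma uniq_incu : uniq incu.
Proof. by apply: (uniq_incu_seq ke_eq). Qed.

Lemma Vt_eq s j s' j' : s <= t -> j < 4 -> s' <= t -> j' < 4 ->
  (Vt t s j == Vt t s' j') = (s == s') && (j == j').
Proof. by move=> *; rewrite -(inj_eq (@code_inj t)) !code_V //; lia. Qed.

Lemma in_inc s j (e : edge (Gt' t)) : s <= t -> j < 4 ->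
  (Some (Vt t s j) \in ends e) = (e \in inc s j).
Proof.
move=> st j4; have [[s' [k [st' k5 ->]]]|[w wS ->]] := edgeP e.
  by rewrite in_ends_ke // code_V // -(in_inc_seq ke_eq (c00 := cE (Vt t 0 0))
    (c02 := cE (Vt t 0 2)) (c1 := fun s => cE (Vt t s 1)) (c3 := fun s => cE (Vt t s 3))).
rewrite in_ends_cE //.
rewrite [RHS]in_inc_seq_c //.
have S1 : odd j || (s == 0) -> Vt t s j \in Sset t by rewrite mem_Sset_V.
have S3 : Vt t s j == w -> odd j || (s == 0).
  by move/eqP => jw; rewrite -(mem_Sset_V st j4) jw.
rewrite eq_sym; move: j j4 S1 S3 => [|[|[|[|]]]] // _ S1 S3.
- case: (eqVneq s 0) S1 S3 => [->|s0] S1 S3; first by rewrite cE_eq // S1.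
  by rewrite eq_sym /=; apply/negP => /S3.
- by rewrite cE_eq // S1.
- case: (eqVneq s 0) S1 S3 => [->|s0] S1 S3; first by rewrite cE_eq // S1.
  by rewrite eq_sym /=; apply/negP => /S3.
- by rewrite cE_eq // S1.
Qed.

Lemma in_incu (e : edge (Gt' t)) : (Some (uu t) \in ends e) = (e \in incu).
Proof.
have [[s' [k [st' k5 ->]]]|[w wS ->]] := edgeP e.
  by rewrite in_ends_ke // -(in_incu_seq ke_eq (cu := cE (uu t))).
by rewrite in_ends_cE // /incu !inE !cE_ke cE_eq ?uu_Sset // eq_sym.
Qed.

End Ladder.

Definition odd13 (b : bool) (n : nat) : bool := (n == 1) || b && (n == 3).

Lemma odd13_parity d (x y c : bool) : odd13 d (x + y + c) -> c = (x == y).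
Proof. by case: d x y c => [] [] [] []. Qed.

(** Once the third edge is the one forced by parity, the degree is odd, and the only condition left
    is whether degree 3 is allowed. *)
Lemma odd13_and d (x y : bool) : odd13 d (x + y + (x == y)) = ~~ (x && y) || d.
Proof. by case: d x y => [] [] []. Qed.

Lemma layer_ok_odd g T2 T4 first last ai bi p q r a b :
  layer_ok g T2 T4 first last ai bi (p, q, r, a, b) =
  [&& odd13 (first && g) (p + a + (if first then p == a else ai)),
      odd13 (if last then T2 else g) (p + q + (p == q)),
      odd13 (first && g) (q + r + (if first then q == r else bi)) &
      odd13 (if last then T4 else g) (r + b + (r == b))].
Proof.
rewrite !odd13_and /layer_ok /lay_p /lay_q /lay_r /lay_a /lay_b /=.
by case: first => /=; rewrite ?odd13_and /odd13 ?orbF; congr (_ && _); apply: andbCA.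
Qed.

(** * From odd factors of G'_t to valid words *)

Section Factor.
Variable t : nat.
Local Notation E' := (edge (Gt' t)).
Local Notation ke := (ladder_edge t).

Lemma degree_Vt s j (F : {set E'}) : s <= t -> j < 4 ->
  #|F :&: incident (Some (Vt t s j) : vert (Gt' t))| = \sum_(e <- inc t s j) (e \in F).
Proof.
by move=> st j4; apply: incident_card => [|e]; [apply: uniq_inc|apply: in_inc].
Qed.

Lemma degree_uu (F : {set E'}) :
  #|F :&: incident (Some (uu t) : vert (Gt' t))| = \sum_(e <- incu t) (e \in F).
Proof. by apply: incident_card => [|e]; [apply: uniq_incu|apply: in_incu]. Qed.

Lemma Posz_sum n (f : 'I_n -> nat) :
  ((\sum_(i < n) f i)%N%:Z = \sum_(i < n) (f i)%:Z)%R.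
Proof. exact: (big_morph Posz PoszD erefl). Qed.

Lemma degree_u' (F : {set E'}) :
  #|F :&: incident (u' t)| =
  \sum_(s < t.+1) ((cE (Vt t s 1) \in F) + (cE (Vt t s 3) \in F)) +
  ((cE (Vt t 0 0) \in F) + (cE (Vt t 0 2) \in F) + (cE (uu t) \in F)).
Proof.
have -> : #|F :&: incident (u' t)| = \sum_(v in Sset t) (cE v \in F).
  rewrite setIC -sum_nat_mem -(@big_imset _ _ _ _ _ (@cE t) _ (fun e : E' => (e \in F) :
    nat)) /=.
    apply: eq_bigl => e; rewrite inE; apply/idP/imsetP => [|[v vS ->]]; last first.
      by rewrite ends_cE // !inE eqxx.
    have [[s [k [st k5 ->]]]|[w wS ->]] := edgeP e; last by exists w.
    by move=> /imsetP[].
  by move=> v w vS wS /eqP; rewrite cE_eq // => /eqP.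
(* The sum over S is available for integers, in [big_Sset]. *)
apply/eqP; rewrite -eqz_nat; apply/eqP; rewrite PoszD Posz_sum.
have -> : ((\sum_(v in Sset t) (cE v \in F))%N%:Z = \sum_(v in Sset t) (cE v \in F)%:Z)%R.
  exact: (big_morph Posz PoszD erefl).
rewrite big_Sset; congr (_ + _)%R.
Qed.

Lemma vertP (v : vert (Gt' t)) :
  v = u' t \/ v = Some (uu t) \/ exists s j, [/\ s <= t, j < 4 & v = Some (Vt t s j)].
Proof.
case: v => [v|]; [right|by left]; have [->|[s [j [st j4 ->]]]] := VtP v; first by left.
by right; exists s, j.
Qed.

Lemma degree_Gt' (v : vert (Gt' t)) : v != u' t -> degree v = 3.
Proof.
have [->|[->|[s [j [st j4 ->]]]]] := vertP v => vu; first by rewrite eqxx in vu.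
  by rewrite /degree -(setTI (incident _)) degree_uu !big_cons big_nil !inE.
rewrite /degree -(setTI (incident _)) degree_Vt // /inc /inc_seq.
by case: j {j4 vu} => [|[|[|j]]]; rewrite !big_cons big_nil !inE.
Qed.

Definition lay_of (F : {set E'}) (s : nat) : layer :=
  (ke s 0 \in F, ke s 1 \in F, ke s 2 \in F, ke s 3 \in F, ke s 4 \in F).

(* The edges at u' are forced by parity at their other ends. *)
Definition spokes (F : {set E'}) : Prop :=
  [/\ forall s, s <= t -> (cE (Vt t s 1) \in F) = ((ke s 0 \in F) == (ke s 1 \in F)),
      forall s, s <= t -> (cE (Vt t s 3) \in F) = ((ke s 2 \in F) == (ke s 4 \in F)),
      (cE (Vt t 0 0) \in F) = ((ke 0 0 \in F) == (ke 0 3 \in F)),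
      (cE (Vt t 0 2) \in F) = ((ke 0 1 \in F) == (ke 0 2 \in F)) &
      (cE (uu t) \in F) = ((ke t 3 \in F) == (ke t 4 \in F))].

Definition word_of (F : {set E'}) : seq layer := mkseq (lay_of F) t.+1.

Lemma nth_word_of F s : s <= t -> nth lay0 (word_of F) s = lay_of F s.
Proof. by move=> st; rewrite nth_mkseq. Qed.

Variables (g T2 T4 Tu : bool) (T : {set vert (Gt' t)}).
Hypothesis Tu' : u' t \notin T.
Hypothesis TV0 : forall s, s <= t -> (Some (Vt t s 0) \in T) = (s == 0) && g.
Hypothesis TV2 : forall s, s <= t -> (Some (Vt t s 2) \in T) = (s == 0) && g.
Hypothesis TV1 : forall s, s <= t -> (Some (Vt t s 1) \in T) = if s == t then T2 else g.
Hypothesis TV3 : forall s, s <= t -> (Some (Vt t s 3) \in T) = if s == t then T4 else g.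
Hypothesis Tuu : (Some (uu t) \in T) = Tu.

Lemma odd_factorP F : odd_factor T F <->
  [/\ forall s, s <= t -> [/\ 
        odd13 ((s == 0) && g) ((ke s 0 \in F) + (ke s 3 \in F) +
          (if s is s'.+1 then ke s' 3 \in F else cE (Vt t 0 0) \in F)),
        odd13 (if s == t then T2 else g) ((ke s 0 \in F) + (ke s 1 \in F) + (cE (Vt t s 1)
          \in F)),
        odd13 ((s == 0) && g) ((ke s 1 \in F) + (ke s 2 \in F) +
          (if s is s'.+1 then ke s' 4 \in F else cE (Vt t 0 2) \in F)) &
        odd13 (if s == t then T4 else g) ((ke s 2 \in F) + (ke s 4 \in F) + (cE (Vt t s 3)
          \in F))],
      odd13 Tu ((ke t 3 \in F) + (ke t 4 \in F) + (cE (uu t) \in F)) &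
      #|F :&: incident (u' t)| = 1].
Proof.
split=> [/forallP oF|[h1 h2 h3]].
  split.
  - move=> s st; split.
    + by have := oF (Some (Vt t s 0));
      rewrite degree_Vt // TV0 // !big_cons big_nil addn0 addnA; case: s {st}.
    + by have := oF (Some (Vt t s 1));
      rewrite degree_Vt // TV1 // !big_cons big_nil addn0 addnA.
    + by have := oF (Some (Vt t s 2));
      rewrite degree_Vt // TV2 // !big_cons big_nil addn0 addnA; case: s {st}.
    + by have := oF (Some (Vt t s 3));
      rewrite degree_Vt // TV3 // !big_cons big_nil addn0 addnA.
  - by have := oF (Some (uu t)); rewrite degree_uu Tuu !big_cons big_nil addn0 addnA.
  - by have := oF (u' t); rewrite (negPf Tu') orbF => /eqP.
apply/forallP => v; have [->|[->|[s [j [st j4 ->]]]]] := vertP v.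
- by rewrite h3.
- by rewrite degree_uu Tuu !big_cons big_nil addn0 addnA.
have [k0 k1 k2 k3] := h1 s st; rewrite degree_Vt // /inc /inc_seq.
move: j j4 => [|[|[|[|]]]] // _;
  rewrite ?TV0 ?TV1 ?TV2 ?TV3 // !big_cons big_nil addn0 addnA //.
  by move: k0; case: s {st k1 k2 k3}.
by move: k2; case: s {st k1 k0 k3}.
Qed.

Lemma prev_a F s : s <= t.+1 -> lay_prev lay_a false (word_of F) s =
  if s is s'.+1 then ke s' 3 \in F else false.
Proof. by case: s => //= s st; rewrite nth_word_of. Qed.

Lemma prev_b F s : s <= t.+1 -> lay_prev lay_b false (word_of F) s =
  if s is s'.+1 then ke s' 4 \in F else false.
Proof. by case: s => //= s st; rewrite nth_word_of. Qed.

Lemma sum_layer_count F : spokes F ->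
  \sum_(s < t.+1) layer_count (true && (s == 0 :> nat)) (nth lay0 (word_of F) s)
  + ((ke t 3 \in F) == (ke t 4 \in F)) = #|F :&: incident (u' t)|.
Proof.
move=> [c1 c3 c00 c02 cu]; rewrite degree_u' cu c00 c02 addnA; congr addn.
rewrite (eq_bigr (fun s : 'I_t.+1 => ((cE (Vt t s 1) \in F) + (cE (Vt t s 3) \in F)) +
   (if s == ord0 then ((ke 0 0 \in F) == (ke 0 3 \in F)) + ((ke 0 1 \in F) == (ke 0 2 \in
     F)) else 0))).
  by rewrite big_split /= -big_mkcond big_pred1_eq.
move=> s _; rewrite nth_word_of ?leq_ord // c1 ?leq_ord // c3 ?leq_ord // -[s ==
  ord0]val_eqE.
rewrite /layer_count /lay_of /lay_p /lay_q /lay_r /lay_a /lay_b /=.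
by case: eqP => [->|_]; rewrite ?add0n ?addn0 // -addnA addnC.
Qed.

Lemma layer_ok_of F s : spokes F -> s <= t ->
  layer_ok g T2 T4 (true && (s == 0)) (s.+1 == t.+1) (lay_prev lay_a false (word_of F) s)
    (lay_prev lay_b false (word_of F) s) (nth lay0 (word_of F) s) =
  [&& odd13 ((s == 0) && g) ((ke s 0 \in F) + (ke s 3 \in F) +
          (if s is s'.+1 then ke s' 3 \in F else cE (Vt t 0 0) \in F)),
        odd13 (if s == t then T2 else g) ((ke s 0 \in F) + (ke s 1 \in F) + (cE (Vt t s 1)
          \in F)),
        odd13 ((s == 0) && g) ((ke s 1 \in F) + (ke s 2 \in F) +
          (if s is s'.+1 then ke s' 4 \in F else cE (Vt t 0 2) \in F)) &
        odd13 (if s == t then T4 else g) ((ke s 2 \in F) + (ke s 4 \in F) + (cE (Vt t s 3)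
          \in F))].
Proof.
move=> [c1 c3 c00 c02 _] st; rewrite nth_word_of // prev_a ?prev_b; try exact: ltnW.
rewrite layer_ok_odd eqSS c1 // c3 //.
by case: s st => [|s] st; rewrite ?c00 ?c02.
Qed.

Lemma factor_valid F : odd_factor T F ->
  spokes F /\ valid g T2 T4 Tu true 0 false false (word_of F).
Proof.
move=> /odd_factorP[h1 h2 h3].
have sp : spokes F.
  split.
  - by move=> s st; have [_ /odd13_parity + _ _] := h1 s st.
  - by move=> s st; have [_ _ _ /odd13_parity] := h1 s st.
  - by have [/odd13_parity + _ _ _] := h1 0 (leq0n t).
  - by have [_ _ /odd13_parity + _] := h1 0 (leq0n t).
  - exact: odd13_parity h2.
split=> //; apply/validP; rewrite size_mkseq; split.
- by move=> s st; rewrite layer_ok_of //; apply/and4P; apply: h1.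
- by rewrite prev_a // prev_b // add0n sum_layer_count // h3.
rewrite prev_a // prev_b //; move: h2; move: sp => [_ _ _ _ ->].
by rewrite odd13_and.
Qed.

Lemma valid_factor F : spokes F ->
  valid g T2 T4 Tu true 0 false false (word_of F) -> odd_factor T F.
Proof.
move=> sp /validP; rewrite size_mkseq => -[h1 h2 h3]; apply/odd_factorP; split.
- by move=> s st; have := h1 s st; rewrite layer_ok_of // => /and4P.
- move: h3; rewrite prev_a // prev_b //; move: sp => [_ _ _ _ ->].
  by rewrite odd13_and.
by rewrite -sum_layer_count //; move: h2; rewrite prev_a // prev_b // add0n.
Qed.

End Factor.

(** * From valid words to odd factors; matching coveredness of G'_t *)

Section FactorOfWord.
Variable t : nat.
Local Notation E' := (edge (Gt' t)).
Local Notation ke := (ladder_edge t).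

Definition lay_bit (k : nat) (l : layer) : bool :=
  nth false [:: lay_p l; lay_q l; lay_r l; lay_a l; lay_b l] k.

Definition spoke_bit (w : seq layer) (v : vert (Gt t)) : bool :=
  if v is Some (s, j) then
    let l := nth lay0 w s in
    match nat_of_ord j with
    | 0 => lay_p l == lay_a l
    | 1 => lay_p l == lay_q l
    | 2 => lay_q l == lay_r l
    | _ => lay_r l == lay_b l
    end
  else lay_a (nth lay0 w t) == lay_b (nth lay0 w t).

Definition factor_of (w : seq layer) : {set E'} :=
  [set e : edge (Gt t) + {v : vert (Gt t) | v \in Sset t} |
    match e with
    | inl e => [exists s : 'I_t.+1, exists k : 'I_5,
                 (e == kE t s k) && lay_bit k (nth lay0 w s)]
    | inr v => spoke_bit w (val v)
    end].

Lemma factor_of_ke w s k : s <= t -> k < 5 ->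
  (ke s k \in factor_of w) = lay_bit k (nth lay0 w s).
Proof.
move=> st k5; rewrite inE; apply/existsP/idP => [[s' /existsP[k' /andP[]]]|h].
  by rewrite kE_inj ?ltn_ord ?leq_ord // => /andP[/eqP-> /eqP->].
exists (Ordinal (st : s < t.+1)); apply/existsP; exists (Ordinal k5).
by rewrite /= eqxx.
Qed.

Lemma factor_of_cE w v : v \in Sset t -> (cE v \in factor_of w) = spoke_bit w v.
Proof. by move=> vS; rewrite inE /= val_insubd vS. Qed.

Lemma spoke_bit_Vt w s j : s <= t -> j < 4 -> spoke_bit w (Vt t s j) =
  let l := nth lay0 w s in
    match j with
    | 0 => lay_p l == lay_a l
    | 1 => lay_p l == lay_q l
    | 2 => lay_q l == lay_r l
    | _ => lay_r l == lay_b l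
    end.
Proof. by move=> st j4; rewrite /spoke_bit /= !inordK. Qed.

Lemma ends_ke s k : s <= t -> k < 5 ->
  ends (ke s k) = [set Some (kL t s k); Some (kR t s k)].
Proof.
move=> st k5; rewrite [LHS](_ : _ = Some @: ends (kE t s k)) //.
by rewrite ends_kE // imsetU1 imset_set1.
Qed.

Local Opaque ladder_edge cE.

Lemma spokes_factor_of w : spokes (factor_of w).
Proof.
by split=> [s st|s st|||];
  rewrite !factor_of_ke // factor_of_cE ?spoke_bit_Vt ?mem_Sset_V ?uu_Sset.
Qed.

Lemma word_of_factor_of w : size w = t.+1 -> word_of (factor_of w) = w.
Proof.
move=> sw; apply: (@eq_from_nth _ lay0); first by rewrite size_mkseq sw.
move=> s; rewrite size_mkseq => st; rewrite nth_word_of // /lay_of !factor_of_ke //.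
by rewrite /lay_bit /=; case: (nth lay0 w s) => -[[[p q] r] a] b.
Qed.

Lemma spokes_inj (F F' : {set E'}) :
  spokes F -> spokes F' -> word_of F = word_of F' -> F = F'.
Proof.
move=> [c1 c3 c00 c02 cu] [d1 d3 d00 d02 du] FF'.
have kk s k : s <= t -> k < 5 -> (ke s k \in F) = (ke s k \in F').
  move=> st k5; have := congr1 (fun w => nth lay0 w s) FF'; rewrite /= !nth_word_of //.
  by case=> *; move: k k5 => [|[|[|[|[|]]]]].
apply/setP => e; have [[s [k [st k5 ->]]]|[v vS ->]] := edgeP e; first exact: kk.
have [vE|[s [j [st j4 vE]]]] := VtP v; first by rewrite vE cu du; congr (_ == _); apply: kk.
move: vS; rewrite vE mem_Sset_V //;
  move: j j4 {vE} => [|[|[|[|]]]] // _ /= => [/eqP->|_|/eqP->|_].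
- by rewrite c00 d00; congr (_ == _); apply: kk.
- by rewrite (c1 s st) (d1 s st); congr (_ == _); apply: kk.
- by rewrite c02 d02; congr (_ == _); apply: kk.
- by rewrite (c3 s st) (d3 s st); congr (_ == _); apply: kk.
Qed.

Lemma ord0_sum (R : nmodType) (x : R) :
  (\sum_(s < t.+1) (if s == 0%N :> nat then x else 0) = x)%R.
Proof.
rewrite (eq_bigr (fun s : 'I_t.+1 => if s == ord0 then x else 0%R)) //.
by rewrite -big_mkcond big_pred1_eq.
Qed.

Lemma factor_weight (F : {set E'}) (h : E' -> int) : spokes F ->
  (\sum_(e in F) h e =
   word_weight (fun s => h (ke s 0%N)) (fun s => h (ke s 1%N)) (fun s => h (ke s 2))
     (fun s => h (ke s 3)) (fun s => h (ke s 4)) (fun s => h (cE (Vt t s 1)))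
     (fun s => h (cE (Vt t s 3))) (h (cE (Vt t 0 0))) (h (cE (Vt t 0 2))) (h (cE (uu t)))
     0 false false (word_of F))%R.
Proof.
move=> [c1 c3 c00 c02 cu].
rewrite word_weightE size_mkseq prev_a // prev_b // -cu big_mkcond big_edges big_Sset.
rewrite addrA -big_split addrA; congr (_ + _)%R.
(* The edges from [u'] to u_0^1 and u_0^3 are moved into the summand of layer 0, where
   [layer_weight] counts them. *)
rewrite -[X in (_ + X)%R]ord0_sum -big_split; apply: eq_bigr => s _.
rewrite nth_word_of ?leq_ord // add0n /layer_weight /lay_of /lay_p /lay_q /lay_r /lay_a
  /lay_b /=.
rewrite -(c1 s (leq_ord s)) -(c3 s (leq_ord s)) !addrA; congr (_ + _)%R.
by case: eqP => // ->; rewrite -c00 -c02.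
Qed.

Section Count.
Variables (g T2 T4 Tu : bool) (T : {set vert (Gt' t)}).
Hypothesis Tu' : u' t \notin T.
Hypothesis TV0 : forall s, s <= t -> (Some (Vt t s 0) \in T) = (s == 0) && g.
Hypothesis TV2 : forall s, s <= t -> (Some (Vt t s 2) \in T) = (s == 0) && g.
Hypothesis TV1 : forall s, s <= t -> (Some (Vt t s 1) \in T) = if s == t then T2 else g.
Hypothesis TV3 : forall s, s <= t -> (Some (Vt t s 3) \in T) = if s == t then T4 else g.
Hypothesis Tuu : (Some (uu t) \in T) = Tu.

Lemma factor_of_odd w : size w = t.+1 -> valid g T2 T4 Tu true 0 false false w ->
  odd_factor T (factor_of w).
Proof.
move=> sw v; apply: (valid_factor Tu' TV0 TV2 TV1 TV3 Tuu (spokes_factor_of w)).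
by rewrite word_of_factor_of.
Qed.

Lemma card_odd_factor :
  #|[set F | odd_factor T F]| = size (words g T2 T4 Tu t.+1 true 0 false false).
Proof.
have fv := factor_valid Tu' TV0 TV2 TV1 TV3 Tuu.
rewrite cardE -(size_map (@word_of t)); apply/perm_size/uniq_perm.
- rewrite map_inj_in_uniq ?enum_uniq // => F F'; rewrite !mem_enum !inE.
  by move=> /fv[sF _] /fv[sF' _]; apply: spokes_inj.
- exact: uniq_words.
move=> w; rewrite mem_words; apply/mapP/andP => [[F]|[/eqP sw v]].
  by rewrite mem_enum inE => /fv[_ vF] ->; rewrite size_mkseq eqxx.
exists (factor_of w); last by rewrite word_of_factor_of.
by rewrite mem_enum inE factor_of_odd.
Qed.

End Count.

(** For empty T the odd factors are the perfect matchings of G'_t itself; this is the case where [g]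
    is false. *)
Lemma pm_of_word w : size w = t.+1 -> valid false false false false true 0 false false w ->
  perfect_matching (factor_of w).
Proof.
move=> sw v; have : odd_factor set0 (factor_of w).
  by apply: (@factor_of_odd false false false false) v; rewrite ?inE // => s st;
    rewrite inE ?andbF ?if_same.
move=> /forallP oF; apply/forallP => x; by have := oF x; rewrite inE orbF.
Qed.

Lemma Gt'_connected : connected (Gt' t).
Proof.
have adjS (v : vert (Gt t)) : v \in Sset t ->
  connect (@adjacent (Gt' t)) (Some v) (u' t) /\ connect (@adjacent (Gt' t)) (u' t) (Some
  v).
  move=> vS; split; apply: connect1; apply/existsP; exists (cE v); rewrite ends_cE //.
  by rewrite setUC.
have adjk s k : s <= t -> k < 5 ->
    connect (@adjacent (Gt' t)) (Some (kL t s k)) (Some (kR t s k)) /\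
    connect (@adjacent (Gt' t)) (Some (kR t s k)) (Some (kL t s k)).
  move=> st k5; have eE := ends_ke st k5.
  by split; apply: connect1; apply/existsP; exists (ke s k); rewrite eE // setUC.
have all (v : vert (Gt' t)) : connect (@adjacent (Gt' t)) v (u' t) /\ connect (@adjacent
  (Gt' t)) (u' t) v.
  have [->|[->|[s [j [st j4 ->]]]]] := vertP v; first by split; apply: connect0.
    by apply: adjS; apply: uu_Sset.
  (* u_s^2 is adjacent to [u'], and both u_s^1 and u_s^3 are adjacent to u_s^2. *)
  have S1 : Vt t s 1 \in Sset t by rewrite mem_Sset_V.
  have [h1 h2] := adjS _ S1.
  have [k0 k0'] := adjk s 0 st isT; have [k1 k1'] := adjk s 1 st isT.
  move: j j4 => [|[|[|[|]]]] // _.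
  - by split; [apply: connect_trans k0 h1|apply: connect_trans h2 k0'].
  - by split; [apply: connect_trans k1' h1|apply: connect_trans h2 k1].
  - by apply: adjS; rewrite mem_Sset_V.
by move=> x y; apply: (connect_trans (all x).1 (all y).2).
Qed.

(** Witnesses: the word of copies of [lay_N] for the first and third path edges and for u'u;
    [lay_V1] at s for the [a] edge and u'u_s^2; [lay_V3] at s for the second path edge and u'u_s^4;
    [lay_X] in front for all [b] edges and u'u_0^1; [lay_Y] in front for u'u_0^3. *)
Lemma Gt'_matching_covered : matching_covered (Gt' t).
Proof.
split; first exact: Gt'_connected.
  by rewrite card_option card_option.
have cov w e : size w = t.+1 -> valid false false false false true 0 false false w ->
    e \in factor_of w -> exists2 M, perfect_matching M & e \in M.
  by move=> sw v ew; exists (factor_of w) => //; apply: pm_of_word.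
have nthN s : s <= t -> nth lay0 (nseq t.+1 lay_N) s = lay_N.
  by move=> st; rewrite nth_nseq ltnS st.
have s10 s l : s <= t -> size (nseq s lay_N ++ l :: tail10 (t - s)) = t.+1.
  by move=> st; rewrite size_cat size_nseq /= size_tail10; lia.
have n10 s l r : nth lay0 (nseq s lay_N ++ l :: r) s = l.
  by rewrite nth_cat size_nseq ltnn subnn.
have V1 s : s <= t -> valid false false false false true 0 false false (nseq s lay_N ++
  lay_V1 :: tail10 (t - s)).
  by move=> st; apply: valid_10 => //; case: (s == 0); case: (s == t).
have V3 s : s <= t -> valid false false false false true 0 false false (nseq s lay_N ++
  lay_V3 :: tail10 (t - s)).
  by move=> st; apply: valid_10 => //; case: (s == 0); case: (s == t).
have VX : valid false false false false true 0 false false (lay_X :: tail01 t).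
  by have := @valid_01 false false false false t 0 lay_X isT; rewrite subn0; apply.
have VY : valid false false false false true 0 false false (lay_Y :: tail01 t).
  by have := @valid_01 false false false false t 0 lay_Y isT; rewrite subn0; apply.
have VN := valid_N false false false false t.+1.
have sN : size (nseq t.+1 lay_N) = t.+1 by rewrite size_nseq.
move=> e; have [[s [k [st k5 ->]]]|[v vS ->]] := edgeP e.
  move: k k5 => [|[|[|[|[|]]]]] // _.
  - by apply: (cov _ _ sN VN); rewrite factor_of_ke // nthN.
  - by apply: (cov _ _ (s10 s _ st) (V3 s st)); rewrite factor_of_ke // n10.
  - by apply: (cov _ _ sN VN); rewrite factor_of_ke // nthN.
  - by apply: (cov _ _ (s10 s _ st) (V1 s st)); rewrite factor_of_ke // n10.
  - apply: (cov _ _ _ VX); first by rewrite /= size_tail01.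
    rewrite factor_of_ke //; case: s st => [|s] st //.
    by rewrite /= nth_nseq st.
have [vE|[s [j [st j4 vE]]]] := VtP v.
  by apply: (cov _ _ sN VN); rewrite factor_of_cE // vE /spoke_bit /= nthN.
move: vS; rewrite vE => vS; move: (vS); rewrite mem_Sset_V //.
move: j j4 {vE} vS => [|[|[|[|]]]] // _ vS /= h.
- apply: (cov _ _ _ VX); first by rewrite /= size_tail01.
  by rewrite factor_of_cE // spoke_bit_Vt // (eqP h).
- by apply: (cov _ _ (s10 s _ st) (V1 s st)); rewrite factor_of_cE // spoke_bit_Vt // n10.
- apply: (cov _ _ _ VY); first by rewrite /= size_tail01.
  by rewrite factor_of_cE // spoke_bit_Vt // (eqP h).
- by apply: (cov _ _ (s10 s _ st) (V3 s st)); rewrite factor_of_cE // spoke_bit_Vt // n10.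
Qed.

Lemma big_vert (h : vert (Gt' t) -> int) :
  (\sum_v h v = h (u' t) + h (Some (uu t)) + \sum_(s < t.+1)
    (h (Some (Vt t s 0)) + h (Some (Vt t s 1)) + h (Some (Vt t s 2)) + h (Some (Vt t s
      3))))%R.
Proof.
rewrite (bigD1 (u' t)) //= (bigD1 (Some (uu t))) //= addrA; congr (_ + _)%R.
pose f (x : 'I_t.+1 * 'I_4) : vert (Gt' t) := Some (Some x).
rewrite (eq_bigl (fun v => v \in [set f x | x : 'I_t.+1 * 'I_4])); last first.
  move=> v; apply/andP/imsetP => [[vu vuu]|[x _ ->]] //.
  by case: v vu vuu => [[x|]|] // _ _; exists x.
rewrite big_imset /= => [|x y _ _ []] //.
rewrite (eq_bigl predT) => [|x]; last by rewrite inE.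
rewrite (eq_bigr (fun p => h (f (p.1, p.2)))) => [|[] //].
rewrite -(pair_bigA _ (fun s k => h (f (s, k)))) /=.
have fE (s : 'I_t.+1) (k : 'I_4) : f (s, k) = Some (Vt t s k) by rewrite /Vt !inord_val.
by apply: eq_bigr => s _;
  rewrite !big_ord_recl big_ord0 /= addr0 !fE /= /bump !leq0n !add1n !addrA.
Qed.

End FactorOfWord.

(** * Tight cuts of the triangle-insertion *)

Section Brick.
Variables (t : nat) (T2 T4 Tu : bool) (T : {set vert (Gt' t)}).
Hypothesis t1 : 0 < t.
Hypothesis Tu' : u' t \notin T.
Hypothesis TV0 : forall s, s <= t -> (Some (Vt t s 0) \in T) = (s == 0) && true.
Hypothesis TV2 : forall s, s <= t -> (Some (Vt t s 2) \in T) = (s == 0) && true.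
Hypothesis TV1 : forall s, s <= t -> (Some (Vt t s 1) \in T) = if s == t then T2 else true.
Hypothesis TV3 : forall s, s <= t -> (Some (Vt t s 3) \in T) = if s == t then T4 else true.
Hypothesis Tuu : (Some (uu t) \in T) = Tu.

Local Notation TI := (triangle_insertion T).
Local Notation ke := (ladder_edge t).
Local Opaque ladder_edge cE.

Lemma T_degree v : v \in T -> degree v = 3.
Proof. by move=> vT; apply: degree_Gt'; apply: contraNneq Tu' => <-. Qed.

Lemma TI_matching_covered : matching_covered TI.
Proof. exact/ti_matching_covered/Gt'_matching_covered/T_degree. Qed.

Lemma TI_matching : exists M : {set edge TI}, perfect_matching M.
Proof.
exists (ti_lift T (factor_of t (nseq t.+1 lay_N))).
apply: (ti_lift_matching T_degree); apply: perfect_matching_odd_factor.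
by apply: pm_of_word; rewrite ?size_nseq //; apply: valid_N.
Qed.

Section TightCut.
Variable X : {set vert TI}.
Hypothesis tX : tight_cut X.

Local Open Scope ring_scope.

Definition fcut (e : edge (Gt' t)) : int := ((inl e : edge TI) \in cut X)%:Z.

Definition gcut (e : edge (Gt' t)) : int :=
  fcut e - \sum_(v in ends e) if v \in T then corner_weight X v e else 0.

Local Notation gp := (fun s => gcut (ke s 0%N)).
Local Notation gq := (fun s => gcut (ke s 1%N)).
Local Notation gr := (fun s => gcut (ke s 2%N)).
Local Notation ga := (fun s => gcut (ke s 3%N)).
Local Notation gb := (fun s => gcut (ke s 4%N)).
Local Notation gc2 := (fun s => gcut (cE (Vt t s 1))).
Local Notation gc4 := (fun s => gcut (cE (Vt t s 3))).
Local Notation gc1 := (gcut (cE (Vt t 0 0))).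
Local Notation gc3 := (gcut (cE (Vt t 0 2))).
Local Notation gcu := (gcut (cE (uu t))).

Let K : int := 1 - \sum_x ti_weight X (fun=> 0) x.

Lemma word_weight_K w : size w = t.+1 -> valid true T2 T4 Tu true 0 false false w ->
  word_weight gp gq gr ga gb gc2 gc4 gc1 gc3 gcu 0 false false w = K.
Proof.
move=> sw vw; have oF := factor_of_odd Tu' TV0 TV2 TV1 TV3 Tuu sw vw.
have := factor_weight gcut (spokes_factor_of t w); rewrite word_of_factor_of // => <-.
exact: (ti_tight_cut_factor T_degree tX oF).
Qed.

(** The potential is to vanish at u_0^2, which lies in T, so the edge from there to [u'] fixes the
    value at [u'], and the edge u'u then fixes the value at u. *)
Definition lam (v : vert (Gt' t)) : int :=
  match v with
  | None => gcut (cE (Vt t 0 1))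
  | Some None => gcu - gcut (cE (Vt t 0 1))
  | Some (Some (s, j)) =>
    match nat_of_ord j with
    | 0%N => lam1 gp ga s
    | 1%N => lam2 gc2 t s
    | 2%N => lam3 gb s
    | _ => lam4 gc2 gc4 t s
    end
  end.

Arguments lam : simpl never.

Lemma lam_V s j : (s <= t)%N -> (j < 4)%N -> lam (Some (Vt t s j)) =
    match j with
    | 0%N => lam1 gp ga s
    | 1%N => lam2 gc2 t s
    | 2%N => lam3 gb s
    | _ => lam4 gc2 gc4 t s
    end.
Proof. by move=> st j4; rewrite /lam /= !inordK. Qed.

Lemma lam_T0 v : v \in T -> lam v = 0.
Proof.
have [h1 h2 h3] := lam_T t1 word_weight_K.
have [->|[->|[s [j [st j4 ->]]]]] := vertP v; first by rewrite (negPf Tu').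
  by rewrite Tuu => /h3.
rewrite lam_V //; move: j j4 => [|[|[|[|]]]] // _; rewrite ?TV0 ?TV1 ?TV2 ?TV3 //.
- by rewrite andbT => /eqP->.
- by case: eqP => [->|/eqP/negPf st'] => [/h1 //|_]; rewrite /lam2 st'.
- by rewrite andbT => /eqP->.
- by case: eqP => [->|/eqP/negPf st'] => [/h2 //|_]; rewrite /lam4 st'.
Qed.

Definition yw (v : vert (Gt' t)) (e : edge (Gt' t)) : int :=
  if v \in T then corner_weight X v e else lam v.

(** As [lam] is 0 on T, restoring the corner weights that [gcut] had subtracted turns [lam] into
    [yw] at the ends in T and changes nothing elsewhere. *)
Lemma fcut_of_gcut e x y : x != y -> ends e = [set x; y] ->
  gcut e = lam x + lam y -> fcut e = yw x e + yw y e.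
Proof.
move=> xy eE; rewrite /gcut (sum_ends _ xy eE) /yw.
have := @lam_T0 x; have := @lam_T0 y.
case: (x \in T) => [hy /(_ isT)|hy _]; case: (y \in T) hy => [/(_ isT)|_]; lia.
Qed.

Lemma fcut_yw e x y : x != y -> ends e = [set x; y] -> fcut e = yw x e + yw y e.
Proof.
move=> xy eE; suff h : exists x' y', [/\ x' != y', ends e = [set x';
  y'] & fcut e = yw x' e + yw y' e].
  have [x' [y' [xy' eE' ->]]] := h.
  by rewrite -(sum_ends (fun v => yw v e) xy' eE') -(sum_ends (fun v => yw v e) xy eE).
have [[s [k [st k5 ek]]]|[v vS ek]] := edgeP e; last first.
  exists None, (Some v); split=> //; first by rewrite ek ends_cE.
  apply: fcut_of_gcut => //; first by rewrite ek ends_cE.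
  rewrite ek; have [->|[s [j [st j4 vE]]]] := VtP v; first by rewrite /lam /=; lia.
  rewrite vE lam_V //; move: vS; rewrite vE mem_Sset_V //.
  have [h1 h2 h3 h4 h5] := layer0 t1 word_weight_K.
  have [h6 h7] := potential_gc t1 word_weight_K st.
  move: j j4 {vE} => [|[|[|[|]]]] // _ /eqP-> /=; by rewrite addr0.
exists (Some (kL t s k)), (Some (kR t s k)).
have ne : Some (kL t s k) != Some (kR t s k).
  apply/eqP => -[/(congr1 (@code t))]; rewrite code_kL // code_kR // /cL /cR.
  by case: k k5 {ek} => [|[|[|[|[|]]]]] //= _; case: (ltnP s t) => _; lia.
have eE' : ends e = [set Some (kL t s k); Some (kR t s k)] by rewrite ek ends_ke.
split=> //; apply: fcut_of_gcut => //; rewrite ek {ek eE' ne eE xy x y}.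
have [ts|ts] := leqP t s.
  have sE : s = t by lia.
  rewrite sE; have [h1 h2 h3 h4 h5] := potential_t t1 word_weight_K.
  move: k k5 => [|[|[|[|[|]]]]] // _; rewrite /kL /kR /= ?ltnn !lam_V //.
have [h1 h2 h3 h4 h5] := potential_lt t1 word_weight_K ts.
have l2 : lam2 gc2 t s = 0 by rewrite /lam2 ltn_eqF.
have l4 : lam4 gc2 gc4 t s = 0 by rewrite /lam4 ltn_eqF.
have L j := @lam_V s j (ltnW ts); have L' j := @lam_V s.+1 j ts.
move: k k5 => [|[|[|[|[|]]]]] k5; last by [].
- by rewrite /kL /kR /= (L 0%N) ?(L 1%N) // l2 addr0; exact: h1.
- by rewrite /kL /kR /= (L 1%N) ?(L 2%N) // l2 add0r; exact: h2.
- by rewrite /kL /kR /= (L 2%N) ?(L 3%N) // l4 addr0; exact: h3.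
- by rewrite /kL /kR /= ts (L 0%N) ?(L' 0%N) //; exact: h4.
- by rewrite /kL /kR /= ts (L 3%N) ?(L' 2%N) // l4 add0r; exact: h5.
Qed.

Lemma fcut_bit e : bit01 (fcut e).
Proof. by rewrite /bit01 /fcut; case: (_ \in _). Qed.

Lemma yw_bit e x y : x != y -> ends e = [set x; y] -> bit01 (yw x e + yw y e).
Proof. by move=> xy eE; rewrite -(fcut_yw xy eE); apply: fcut_bit. Qed.

Definition dw (v : vert (Gt' t)) : int :=
  if v \in T then \sum_(e in incident v) corner_weight X v e else lam v.

Lemma dw_split v e1 e2 e3 : uniq [:: e1; e2; e3] ->
  (forall e, (v \in ends e) = (e \in [:: e1; e2; e3])) ->
  split_weight (v \in T) (dw v) (yw v e1) (yw v e2) (yw v e3).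
Proof.
move=> ue ve; rewrite /split_weight /dw /yw; case: (boolP (v \in T)) => [vT|_ //].
have := corner_weight_sum T_degree X vT.
rewrite (incident_sum ue ve) !big_cons big_nil addr0 addrA => h.
by do !split=> //; apply: corner_weight_ge0.
Qed.

Lemma yw_ke_bit s k : (s <= t)%N -> (k < 5)%N ->
  bit01 (yw (Some (kL t s k)) (ke s k) + yw (Some (kR t s k)) (ke s k)).
Proof.
move=> st k5; apply: yw_bit; last exact: ends_ke.
apply/eqP => -[/(congr1 (@code t))]; rewrite code_kL // code_kR // /cL /cR.
by case: k k5 => [|[|[|[|[|]]]]] //= _; case: (ltnP s t) => _; lia.
Qed.

Lemma yw_cE_bit v : v \in Sset t -> bit01 (lam None + yw (Some v) (cE v)).
Proof.
move=> vS; have := @yw_bit (cE v) None (Some v) isT (ends_cE vS).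
by rewrite [yw None _](_ : _ = lam None) // /yw (negPf Tu').
Qed.

Lemma dw_total : \sum_v dw v = 1.
Proof.
have fE e : fcut e = \sum_(v in ends e) (if v \in T then corner_weight X v e else lam v).
  by have [x [y [xy eE]]] := set2_ends e; rewrite (fcut_yw xy eE) (sum_ends _ xy eE).
have [conn _ _] := TI_matching_covered.
by have [] := ti_tight_cut_trivial T_degree conn TI_matching tX fE.
Qed.

(** The bounds of Section [Positivity] are applied with [dw] as the weights and [yw] as their parts:
    edges give values 0 or 1 by [yw_bit], and [dw_total] gives the total. *)
Lemma dw_ge0 v : 0 <= dw v.
Proof.
pose Y s j e := yw (Some (Vt t s j)) e.
(* The third edge at u_s^1, and below at u_s^3: it comes from the preceding layer or, in layer 0,
   from [u']. *)
pose a' s := if s is s'.+1 then ke s' 3 else cE (Vt t 0 0).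
pose b' s := if s is s'.+1 then ke s' 4 else cE (Vt t 0 2).
have sp1 s : (s <= t)%N -> split_weight (s == 0%N) (dw (Some (Vt t s 0)))
    (Y s 0%N (ke s 0)) (Y s 0%N (ke s 3)) (Y s 0%N (a' s)).
  move=> st; rewrite -[s == _]andbT -TV0 //; apply: dw_split => [|e].
    exact: (uniq_inc 0 st).
  exact: in_inc.
have sp3 s : (s <= t)%N -> split_weight (s == 0%N) (dw (Some (Vt t s 2)))
    (Y s 2%N (ke s 1)) (Y s 2%N (ke s 2)) (Y s 2%N (b' s)).
  move=> st; rewrite -[s == _]andbT -TV2 //; apply: dw_split => [|e].
    exact: (uniq_inc 2 st).
  exact: in_inc.
have sp2 s : (s <= t)%N -> split_weight ((s == t) ==> T2) (dw (Some (Vt t s 1)))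
    (Y s 1%N (ke s 0)) (Y s 1%N (ke s 1)) (Y s 1%N (cE (Vt t s 1))).
  move=> st; rewrite [_ ==> _](_ : _ = (Some (Vt t s 1) \in T)); last by rewrite TV1 //;
    case: (s == t).
  apply: dw_split => [|e]; first exact: (uniq_inc 1 st).
  exact: in_inc.
have sp4 s : (s <= t)%N -> split_weight ((s == t) ==> T4) (dw (Some (Vt t s 3)))
    (Y s 3%N (ke s 2)) (Y s 3%N (ke s 4)) (Y s 3%N (cE (Vt t s 3))).
  move=> st; rewrite [_ ==> _](_ : _ = (Some (Vt t s 3) \in T)); last by rewrite TV3 //;
    case: (s == t).
  apply: dw_split => [|e]; first exact: (uniq_inc 3 st).
  exact: in_inc.
have spu : split_weight Tu (dw (Some (uu t))) (yw (Some (uu t)) (ke t 3))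
    (yw (Some (uu t)) (ke t 4)) (yw (Some (uu t)) (cE (uu t))).
  rewrite -Tuu; apply: dw_split => [|e]; first exact: uniq_incu.
  exact: in_incu.
have epqr s : (s <= t)%N -> [/\ bit01 (Y s 0%N (ke s 0) + Y s 1%N (ke s 0)),
    bit01 (Y s 1%N (ke s 1) + Y s 2 (ke s 1)) & bit01 (Y s 2 (ke s 2) + Y s 3 (ke s 2))].
  by move=> st; split; [apply: (@yw_ke_bit s 0)|apply: (@yw_ke_bit s 1)|apply: (@yw_ke_bit
    s 2)].
have ec s : (s <= t)%N -> bit01 (lam None + Y s 1%N (cE (Vt t s 1))) /\
    bit01 (lam None + Y s 3 (cE (Vt t s 3))).
  by move=> st; split; apply: yw_cE_bit; rewrite mem_Sset_V.
have eab s : (s < t)%N -> bit01 (Y s 0%N (ke s 3) + Y s.+1 0%N (a' s.+1)) /\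
    bit01 (Y s 3 (ke s 4) + Y s.+1 2 (b' s.+1)).
  move=> st; have := @yw_ke_bit s 3 (ltnW st) isT; have := @yw_ke_bit s 4 (ltnW st) isT.
  by rewrite /kL /kR /= st => h4 h3; exact: (conj h3 h4).
have eabt : bit01 (Y t 0%N (ke t 3) + yw (Some (uu t)) (ke t 3)) /\
    bit01 (Y t 3 (ke t 4) + yw (Some (uu t)) (ke t 4)).
  have := @yw_ke_bit t 3 (leqnn t) isT; have := @yw_ke_bit t 4 (leqnn t) isT.
  by rewrite /kL /kR /= ltnn => h4 h3; exact: (conj h3 h4).
have ec0 : [/\ bit01 (lam None + Y 0%N 0%N (a' 0%N)), bit01 (lam None + Y 0%N 2 (b' 0%N)) &
    bit01 (lam None + yw (Some (uu t)) (cE (uu t)))].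
  by split; apply: yw_cE_bit; rewrite ?mem_Sset_V ?uu_Sset.
have tot : lam None + dw (Some (uu t)) + \sum_(s < t.+1) (dw (Some (Vt t s 0)) +
    dw (Some (Vt t s 1)) + dw (Some (Vt t s 2)) + dw (Some (Vt t s 3))) = 1.
  by rewrite -dw_total big_vert; congr (_ + _ + _); rewrite /dw (negPf Tu').
have [->|[->|[s [j [st j4 ->]]]]] := vertP v.
- rewrite /dw (negPf Tu').
  exact: (c_ge0 t1 sp1 sp3 sp2 sp4 spu epqr ec eabt ec0 tot).
- exact: (Du_ge0 t1 sp1 sp3 sp2 sp4 spu epqr ec eabt ec0 tot).
have [h2 h4] := D24_ge0 t1 sp1 sp3 sp2 sp4 spu epqr ec eabt ec0 tot st.
move: j j4 => [|[|[|[|]]]] // _.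
- exact: (D1_ge0 t1 sp1 sp3 sp2 sp4 spu epqr ec eab eabt ec0 tot st).
- exact: (D3_ge0 t1 sp1 sp3 sp2 sp4 spu epqr ec eab eabt ec0 tot st).
Qed.

Lemma TI_tight_cut_trivial : trivial_cut X.
Proof.
have fE e : fcut e = \sum_(v in ends e) (if v \in T then corner_weight X v e else lam v).
  by have [x [y [xy eE]]] := set2_ends e; rewrite (fcut_yw xy eE) (sum_ends _ xy eE).
have [conn _ _] := TI_matching_covered.
have [_] := ti_tight_cut_trivial T_degree conn TI_matching tX fE.
by apply=> v vT; have := dw_ge0 v; rewrite /dw (negPf vT).
Qed.

End TightCut.

Lemma TI_brick : brick TI.
Proof.
split; first exact: TI_matching_covered.
  apply: (ti_nonbipartite T_degree (v := Some (Vt t 0 0))); by rewrite TV0.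
by move=> X; apply: TI_tight_cut_trivial.
Qed.

Lemma TI_num_perfect_matchings : num_perfect_matchings TI = 5 * t + 7 + T2 + T4 + Tu.
Proof.
rewrite (num_perfect_matchings_ti T_degree) (card_odd_factor Tu' TV0 TV2 TV1 TV3 Tuu).
by case: t t1 => // m _; apply: size_words.
Qed.

End Brick.

(** * The sets S_k and the final count *)

Section Insertion.
Variables (t k : nat).
Hypothesis k14 : 0 < k <= 4.

Lemma in_Sk v : (v \in Sk t k) = (v \in Sset t) &&
  [&& (v == Vt t t 1) ==> (1 < k), (v == Vt t t 3) ==> (2 < k) & (v == uu t) ==> (3 < k)].
Proof.
move: k k14 => [|[|[|[|[|]]]]] // _; rewrite /Sk ?inE /=.
all: rewrite ?implybT ?implybF ?andbT ?negb_or -?[u_ _ _ _]/(Vt _ _ _) /=.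
- by rewrite andbC -andbA.
- by rewrite andbC.
- by rewrite andbC.
- by [].
Qed.

Lemma card_Sk : #|Sk t k| = 2 * t + 1 + k.
Proof.
have ne3 : Vt t t 3 != uu t by [].
have ne13 : Vt t t 1 != Vt t t 3 by rewrite Vt_eq // andbF.
have S1 : Vt t t 1 \in Sset t by rewrite mem_Sset_V.
have S3 : Vt t t 3 \in Sset t by rewrite mem_Sset_V.
have Su := uu_Sset t; have cS := card_Sset t.
have cD (A : {set vert (Gt t)}) : A \subset Sset t -> #|Sset t :\: A| = #|Sset t| - #|A|.
  by move=> sA; rewrite cardsD (setIidPr sA).
move: k k14 => [|[|[|[|[|]]]]] // _; rewrite /Sk.
- rewrite -[u_ t t 2]/(Vt t t 1) -[u_ t t 4]/(Vt t t 3) cD ?subUset ?sub1set ?S1 ?S3 //.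
  by rewrite setUC cardsU1 cards2 ne13 cS !inE /=; lia.
- rewrite -[u_ t t 4]/(Vt t t 3) cD ?subUset ?sub1set ?S3 //.
  rewrite cards2 ne3 cS; lia.
- by rewrite cD ?sub1set // cards1 cS; lia.
- by rewrite cS; lia.
Qed.

Let T : {set vert (Gt' t)} := Some @: Sk t k.

Lemma mem_Some_Sk v : (Some v \in T) = (v \in Sk t k).
Proof. by rewrite mem_imset // => x y []. Qed.

(** As k grows from 1 to 4, S_k gains u_t^2, u_t^4 and u in this order, so the three flags are
    comparisons with k. *)
Lemma Sk_flags : [/\ u' t \notin T,
  forall s, s <= t -> (Some (Vt t s 0) \in T) = (s == 0) && true,
  forall s, s <= t -> (Some (Vt t s 2) \in T) = (s == 0) && true,
  forall s, s <= t -> (Some (Vt t s 1) \in T) = if s == t then 1 < k else true &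
  (forall s, s <= t -> (Some (Vt t s 3) \in T) = if s == t then 2 < k else true) /\
  (Some (uu t) \in T) = (3 < k)].
Proof.
split; first by apply/imsetP => -[].
- by move=> s st; rewrite mem_Some_Sk in_Sk mem_Sset_V // !Vt_eq // !andbF.
- by move=> s st; rewrite mem_Some_Sk in_Sk mem_Sset_V // !Vt_eq // !andbF.
- move=> s st; rewrite mem_Some_Sk in_Sk mem_Sset_V // !Vt_eq // !andbF !andbT /=.
  by case: (s == t).
split; last by rewrite mem_Some_Sk in_Sk uu_Sset.
move=> s st; rewrite mem_Some_Sk in_Sk mem_Sset_V // !Vt_eq // !andbF !andbT /=.
by case: (s == t).
Qed.

End Insertion.

Theorem theorem3p1 (t i n : nat) (ht : 1 <= t) (hi : i \in [:: 2; 4; 6; 8])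
    (hn : n = i + 8 * (t + 1)) :
  [/\ #|Sset t| = 2 * t + 5,
      (forall v : vert (Gt' t), v != u' t -> degree v = 3),
      #|vert (G'' t i)| = n,
      extremal_brick (G'' t i)
    & 8 * num_perfect_matchings (G'' t i) = 5 * n + 8 - i].
Proof.
have [k14 iE] : 0 < i./2 <= 4 /\ i = i./2.*2.
  by move: hi; rewrite !inE => /or4P[] /eqP->.
have [Tu' TV0 TV2 TV1 [TV3 Tuu]] := Sk_flags t k14.
have T3 := T_degree Tu'.
have cT : #|(Some @: Sk t i./2 : {set vert (Gt' t)})| = 2 * t + 1 + i./2.
  by rewrite card_imset ?card_Sk // => x y [].
have cV : #|vert (G'' t i)| = n.
  rewrite /G'' (card_ti_vert T3) cT !card_option card_prod !card_ord; lia.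
have cE' : #|edge (G'' t i)| = 13 * t + 13 + 3 * i./2.
  by rewrite /G'' (card_ti_edge T3) cT card_edge_Gt'; lia.
have pm := TI_num_perfect_matchings ht Tu' TV0 TV2 TV1 TV3 Tuu.
(* Exactly [i./2 - 1] of the three flags hold. *)
have {}pm : num_perfect_matchings (G'' t i) = 5 * t + 6 + i./2.
  by rewrite /G'' pm; move: k14; case: (i./2) => [|[|[|[|[|]]]]] //=; lia.
split=> //.
- exact: card_Sset.
- exact: degree_Gt'.
- split; first exact: (TI_brick ht Tu' TV0 TV2 TV1 TV3 Tuu).
  by rewrite pm cV cE'; lia.
- by rewrite pm; lia.
Qed.
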